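(* Let $r,s\ge1$ be integers, $\beta>0$, $\Theta\in\mathrm{Mat}_{r\times s}(\mathbb{R})$, and let $\varphi:[1,\infty)\to(0,1]$ be a non-increasing function such that $$|\mathbf{p}+\Theta\mathbf{q}|\,|\mathbf{q}|^{\beta}\geq\varphi(|\mathbf{q}|)$$ for every $(\mathbf{p},\mathbf{q})\in\mathbb{Z}^r\times\mathbb{Z}^s$ with $\mathbf{q}\ne\mathbf{0}$. Let $\mathbf{y}\in\mathbb{R}^r$, let $\epsilon=\epsilon(Q)\in(0,1]$ be a function of $Q\ge1$, and suppose that $\epsilon\cdot Q^\beta$ tends to infinity as $Q$ tends to infinity. Suppose $a>2$. Then, as $Q$ tends to infinity, $$N^*_{\Theta,\mathbf{y}}(\epsilon,Q)=\frac{\epsilon^rQ^s}{\zeta(r+s)}+O\left(u^{r+s-1}+u\,a^{\frac{\log\delta}{\log\log\delta}}\right),$$ where $$u=\left(\frac{\epsilon Q^\beta}{\varphi(Q)}\right)^{1/(1+\beta)},\qquad \delta=\left(\frac{1}{\varphi(Q)}\left(\frac{Q}{\epsilon}\right)^\beta\right)^{1/(1+\beta)},$$ and the implied constant does not depend on $Q$.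
   Context: $|\cdot|$ is the Euclidean norm and $\zeta$ the Riemann zeta function. For $Q\ge1$, $0<\epsilon\le1$ and $\mathbf{y}\in\mathbb{R}^r$, $N^*_{\Theta,\mathbf{y}}(\epsilon,Q)$ denotes the number of $(\mathbf{p},\mathbf{q})\in\mathbb{Z}^{r+s}$ with coprime coordinates, i.e. $\gcd(p_1,\ldots,p_r,q_1,\ldots,q_s)=1$, satisfying $\mathbf{p}+\Theta\mathbf{q}-\mathbf{y}\in[0,\epsilon]^r$ and $\mathbf{q}\in[0,Q]^s$ (vectors are treated as column vectors). *)

(* Defs.v *)
From mathcomp Require Import all_boot all_order all_algebra.
From mathcomp Require Import finmap.
From mathcomp Require Import all_classical all_reals all_analysis.

Set Implicit Arguments.
Unset Strict Implicit.
Unset Printing Implicit Defensive.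

Import Order.TTheory GRing.Theory Num.Theory.
Import numFieldNormedType.Exports.

Local Open Scope classical_set_scope.
Local Open Scope ring_scope.

(* The library norm on matrices is the sup norm. *)
Definition euclidean_norm (R : realType) (n : nat) (v : 'cV[R]_n) : R :=
  Num.sqrt (\sum_(i < n) v i 0 ^+ 2).

(* Meaningful for 1 < x; the series diverges for x <= 1. *)
Definition zeta (R : realType) (x : R) : R :=
  limn (series (fun n : nat => (n.+1%:R `^ x)^-1)).

Definition real_vec (R : realType) (n : nat) (v : 'cV[int]_n) : 'cV[R]_n :=
  map_mx (fun z : int => z%:~R) v.

Definition coprime_coords (n : nat) (v : 'cV[int]_n) : Prop :=
  \big[gcdn/0%N]_(i < n) `|v i 0%R|%N = 1%N.

Definition primitive_solutions (R : realType) (r s : nat)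
    (Theta : 'M[R]_(r, s)) (y : 'cV[R]_r) (eps Q : R) :
    set ('cV[int]_r * 'cV[int]_s) :=
  [set pq | [/\ coprime_coords (col_mx pq.1 pq.2),
     forall i, 0 <= (real_vec R pq.1 + Theta *m real_vec R pq.2 - y) i 0 <= eps
   & forall j, 0 <= real_vec R pq.2 j 0 <= Q]].

(* [fset_set] returns the empty set on infinite sets; this never happens here,
   by [finite_primitive_solutions] below. *)
Definition Nstar (R : realType) (r s : nat)
    (Theta : 'M[R]_(r, s)) (y : 'cV[R]_r) (eps Q : R) : nat :=
  #|` fset_set (primitive_solutions Theta y eps Q)|.

Lemma finite_bounded_intvec (n N : nat) :
  finite_set [set v : 'cV[int]_n | forall i, (`|v i 0%R| <= N)%N].
Proof.
pose f (w : 'cV[bool * 'I_N.+1]_n) : 'cV[int]_n :=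
  map_mx (fun x : bool * 'I_N.+1 => (-1) ^+ x.1 * (val x.2)%:Z) w.
apply: (@sub_finite_set _ _ (f @` [set: 'cV[bool * 'I_N.+1]_n])); last first.
  exact/finite_image/finite_finset.
move=> v vN; exists (\col_i (v i 0 < 0, inord `|v i 0%R|%N)) => //.
apply/matrixP => i j; rewrite !mxE /= ord1 inordK ?ltnS //.
by rewrite abszE -intEsign.
Qed.

Lemma finite_primitive_solutions (R : realType) (r s : nat)
    (Theta : 'M[R]_(r, s)) (y : 'cV[R]_r) (eps Q : R) :
  finite_set (primitive_solutions Theta y eps Q).
Proof.
pose B := \sum_i (`|y i 0| + \sum_j `|Theta i j| * `|Q|) + `|eps| + `|Q|.
pose N := (Num.truncn B).+1.
have BN : B < N%:R by exact: truncnS_gt.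
have ge0S i : 0 <= `|y i 0| + \sum_j `|Theta i j| * `|Q|.
  by rewrite addr_ge0 // sumr_ge0 // => j _; rewrite mulr_ge0.
have absN (z : int) : `|z%:~R : R| <= B -> (`|z| <= N)%N.
  move=> zB; rewrite -(ler_nat R); apply/ltW/(le_lt_trans _ BN).
  by rewrite natr_absz intr_norm.
apply: (sub_finite_set _ (finite_setX (finite_bounded_intvec r N)
  (finite_bounded_intvec s N))) => -[p q] [_ /= hp hq].
have hQ j : `|(q j 0)%:~R : R| <= `|Q|.
  have := hq j; rewrite mxE => /andP[q0 qQ].
  by rewrite ger0_norm // (le_trans qQ) // ler_norm.
split => i /=; apply: absN; last first.
  by rewrite (le_trans (hQ i)) // lerDr addr_ge0 // sumr_ge0.
have := hp i; rewrite !mxE; set t := \sum_j _ => /andP[h0 he].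
have ht : `|t| <= \sum_j `|Theta i j| * `|Q|.
  apply: (le_trans (ler_norm_sum _ _ _)); apply: ler_sum => j _.
  by rewrite normrM ler_wpM2l // mxE.
have -> : (p i 0)%:~R = ((p i 0)%:~R + t - y i 0) - t + y i 0 :> R.
  by rewrite addrAC addrNK addrK.
apply: (le_trans (ler_normD _ _)).
apply: (@le_trans _ _ (`|eps| + `|t| + `|y i 0|)).
  rewrite lerD2r (le_trans (ler_normB _ _)) // lerD2r ger0_norm //.
  by rewrite (le_trans he) // ler_norm.
apply: (@le_trans _ _ ((`|y i 0| + \sum_j `|Theta i j| * `|Q|) + `|eps|)).
  by rewrite addrC addrA addrAC lerD2r lerD2l.
rewrite /B (bigD1 i) //= -[leRHS]addrA -[leRHS]addrA lerD2l.
by rewrite addrCA lerDl addr_ge0 // sumr_ge0.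
Qed.

(* Main.v *)
(* In the coordinates x |-> ((p + Theta q) / eps, q / Q) the solutions are the
   points of the lattice Z^(r+s) in a unit cube, and the Diophantine condition
   says that nonzero lattice vectors have length at least 1/u.  A reduced basis
   then yields coordinates z = V x, with V unimodular, each of which varies by
   O(u) on the cube; slicing along the axes of z, the cube shrunk by d contains
   eps^r Q^s / d^(r+s) + O((u/d + 1)^(r+s-1)) points.  Volumes are never used:
   the main term is the limit of the normalised number of points of
   (1/m) Z^(r+s).
   Moebius inversion over d <= u gives the main term.  If d > u is squarefree
   and divides a nonzero solution x, then d divides some nonzero coordinate
   (V x)_i, which lies in an interval of length O(u) and is O(delta), where
   delta = u / eps; so there are O(u 2^omega) such d, with omega the largest
   number of prime divisors of an integer that is O(delta), and each of them
   contributes O(1). *)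

Require Import Defs.
From mathcomp Require Import all_boot all_order all_algebra.
From mathcomp Require Import finmap.
From mathcomp Require Import all_classical all_reals all_analysis.
From mathcomp Require Import ring lra zify.

Set Implicit Arguments.
Unset Strict Implicit.
Unset Printing Implicit Defensive.

Import Order.TTheory GRing.Theory Num.Theory.
Import numFieldNormedType.Exports.

Local Open Scope classical_set_scope.
Local Open Scope ring_scope.

(** * Counting grid points *)

(** Two bounds for the first minimum meet at [1/u]: a vector with long [q] has [|q| / Q] large, one
    with short [q] is controlled by the Diophantine condition. Equating them gives
    [u^(1+beta) = eps Q^beta / phi(Q)]. The comparison of a lattice with its refinement by [m] has
    an error independent of [m]. This is what allows a limit of counts to stand in for the volume.
    The cut at [d = u] is forced: beyond it each count is only O(1), but about [delta] values of [d]
    remain. They can be restricted to divisors of few integers only in coordinates of small range.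
    The original coordinates [q] range over an interval of length [Q], whereas those of [V x] take
    O(u) values. This range is independent of [y]; the size of the values is not, as it involves
    [y / eps], and so both [u] and [delta] occur. The zero vector is divisible by every [d] and is
    taken out of all counts, at a cost of at most 1 for each [d <= u] and of nothing beyond. The
    room between 2 and [a] absorbs the constant in O(delta). The factor [1 + log u], due to the case
    [r + s = 2] and to the truncation of [1/zeta], is absorbed by the term with [a], since
    [u <= delta]. *)

Ltac case_minmax :=
  repeat match goal with |- context [Num.min ?a ?b] => case: (leP a b) => ? end;
  repeat match goal with |- context [Num.max ?a ?b] => case: (leP a b) => ? end.

Lemma count_nat_le (R : realType) (x y : R) (N : nat) (P : pred nat) :
  x <= y -> (forall k, P k -> x <= k%:R <= y) ->
  \sum_(k < N) (P k)%:R <= y - x + 1.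
Proof.
move=> xy Pxy; pose g (t : R) := Num.max x (Num.min t (y + 1)).
have gle t : x <= g t <= y + 1.
  by rewrite /g; case_minmax; apply/andP; split; lra.
(* The indicator of [x, y] at k is at most the increment over [k, k + 1] of the
   clamp g of t to [x, y + 1]; the reverse inequality below clamps to [x + 1, y]. *)
apply: (@le_trans _ _ (\sum_(k < N) (g k.+1%:R - g k%:R))).
  apply: ler_sum => k _; have : P k -> x <= k%:R <= y by exact: Pxy.
  rewrite /g -natr1; case: (P k) => [/(_ isT)/andP[? ?]|_] /=;
    by case_minmax; lra.
rewrite -(big_mkord xpredT (fun k => g k.+1%:R - g k%:R)) telescope_sumr //.
by have /andP[? ?] := gle N%:R; have /andP[? ?] := gle 0; lra.
Qed.

(** The bounds on [x] and [y] put every integer strictly between them among the indices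
    [0, ..., N - 1]. The open interval suffices, so that end points of unknown membership do no
    harm. *)
Lemma count_nat_ge (R : realType) (x y : R) (N : nat) (P : pred nat) :
  -1 <= x -> y <= N%:R -> (forall k, x < k%:R < y -> P k) ->
  y - x - 1 <= \sum_(k < N) (P k)%:R.
Proof.
move=> x0 yN Pxy; have [yx|xy] := leP y (x + 1).
  by apply: (@le_trans _ _ 0); [lra|apply: sumr_ge0].
pose g (t : R) := Num.max (x + 1) (Num.min t y).
apply: (@le_trans _ _ (\sum_(k < N) (g k.+1%:R - g k%:R))).
  rewrite -(big_mkord xpredT (fun k => g k.+1%:R - g k%:R)) telescope_sumr //.
  by rewrite /g; case_minmax; lra.
apply: ler_sum => k _; have : x < k%:R < y -> P k by exact: Pxy.
rewrite /g -natr1; case: (P k) => [_|nP] /=; first by case_minmax; lra.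
have [kx|kx] := leP k%:R x; last have [ky|ky] := leP y k%:R.
- by case_minmax; lra.
- by case_minmax; lra.
- by have := nP; rewrite kx ky => /(_ isT).
Qed.

Definition grid_point (R : realType) (c m k : nat) : R := (k%:R - c%:R) / m%:R.

(* The sum runs over the points of (1/m)Z in [-c/m, c/m]; it approximates the
   length of J when J lies in this interval. *)
Definition grid_mass (R : realType) (c m : nat) (J : pred R) : R :=
  m%:R^-1 * \sum_(k < c.*2.+1) (J (grid_point R c m k))%:R.

Lemma grid_mass_le (R : realType) (c m : nat) (J : pred R) (x y : R) :
  (0 < m)%N -> x <= y -> (forall t, J t -> x <= t <= y) ->
  grid_mass c m J <= y - x + m%:R^-1.
Proof.
move=> m0 xy Jxy; rewrite /grid_mass.
have mR : 0 < m%:R :> R by rewrite ltr0n.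
have := @count_nat_le R (m%:R * x + c%:R) (m%:R * y + c%:R) c.*2.+1
  (fun k => J (grid_point R c m k)).
rewrite lerD2r ler_pM2l // => /(_ xy) H.
rewrite mulrC ler_pdivrMr // mulrDl mulVf ?gt_eqF //.
apply: le_trans (H _) _; last by lra.
move=> k /Jxy; rewrite /grid_point ler_pdivlMr // ler_pdivrMr //.
by move=> ?; lra.
Qed.

Lemma grid_mass_ge (R : realType) (c m : nat) (J : pred R) (x y : R) :
  (0 < m)%N -> - c%:R <= m%:R * x -> m%:R * y <= c%:R ->
  (forall t, x < t < y -> J t) ->
  y - x - m%:R^-1 <= grid_mass c m J.
Proof.
move=> m0 xc yc Jxy; rewrite /grid_mass.
have mR : 0 < m%:R :> R by rewrite ltr0n.
have := @count_nat_ge R (m%:R * x + c%:R) (m%:R * y + c%:R) c.*2.+1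
  (fun k => J (grid_point R c m k)).
move=> H.
rewrite [leRHS]mulrC ler_pdivlMr // mulrBl mulVf ?gt_eqF //.
apply: le_trans (H _ _ _); first lra.
- by lra.
- by rewrite -natr1 -addnn natrD; lra.
- move=> k kxy; apply: Jxy; rewrite /grid_point ltr_pdivlMr // ltr_pdivrMr //.
  by lra.
Qed.

(** A bounded convex set of reals is an interval, and [l] is its length. The point is that [l]
    depends neither on [c] nor on [m]: grids of different steps are compared through it. *)
Lemma grid_mass_convex (R : realType) (J : pred R) (B : R) :
  (forall t, J t -> `|t| <= B) ->
  (forall t1 t2 t, J t1 -> J t2 -> t1 <= t <= t2 -> J t) ->
  exists l : R, forall c m, (0 < m)%N -> m%:R * B <= c%:R ->
    `|grid_mass c m J - l| <= m%:R^-1.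
Proof.
move=> JB Jc; have [[t0 Jt0]|J0] := pselect (exists t, J t); last first.
  exists 0 => c m m0 _; rewrite subr0 /grid_mass big1 ?mulr0 ?normr0 ?invr_ge0 //.
  by move=> k _; case: (boolP (J _)) => // Jk; case: J0; eexists; exact: Jk.
pose S := [set t | J t].
have JB' t : J t -> - B <= t <= B by move=> /JB; rewrite ler_norml.
have Ssup : has_sup S.
  by split; [exists t0|exists B; move=> t /JB' /andP[]].
have Sinf : has_inf S.
  by split; [exists t0|exists (- B); move=> t /JB' /andP[]].
have hle t : J t -> inf S <= t <= sup S.
  move=> Jt; rewrite (ub_le_sup Ssup.2) // andbT.
  by apply: ge_inf Jt; exact: Sinf.2.
have hlt t : inf S < t < sup S -> J t.
  move=> /andP[/(inf_lt Sinf.1)[t1 Jt1 lt1] /(sup_gt Ssup.1)[t2 Jt2 lt2]].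
  by apply: (Jc _ _ _ Jt1 Jt2); rewrite !ltW.
have infB : - B <= inf S.
  by apply: lb_le_inf => [|t /JB' /andP[]//]; exists t0.
have supB : sup S <= B.
  by apply: ge_sup => [|t /JB' /andP[]//]; exists t0.
exists (sup S - inf S) => c m m0 Bc.
have mR : 0 < m%:R :> R by rewrite ltr0n.
rewrite ler_norml; apply/andP; split.
  rewrite lerBrDr addrC; apply: grid_mass_ge => //.
  - by rewrite lerNl -mulrN; apply: le_trans Bc; rewrite ler_pM2l //; lra.
  - by apply: le_trans Bc; rewrite ler_pM2l.
rewrite lerBlDr addrC; apply: grid_mass_le => //.
by have /andP[h1 h2] := hle _ Jt0; apply: le_trans h1 h2.
Qed.

(** This slices along the axis [j] without a type for the remaining coordinates: [f] runs over all
    functions and its value at [j] is overwritten, so that each slice is counted [#|T|] times. *)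
Lemma sum_ffun_update (R : realType) (I T : finType)
    (F : {ffun I -> T} -> R) (j : I) :
  #|T|%:R * \sum_f F f =
  \sum_(f : {ffun I -> T}) \sum_(k : T) F [ffun i => if i == j then k else f i].
Proof.
rewrite pair_big /=.
(* Swapping k with the value of f at j is an involution. *)
pose h (x : {ffun I -> T} * T) : {ffun I -> T} * T :=
  ([ffun i => if i == j then x.2 else x.1 i], x.1 j).
have hK : involutive h.
  case=> f k; rewrite /h /= ffunE eqxx; congr pair.
  by apply/ffunP => i; rewrite !ffunE /=; case: eqP => // ->.
transitivity (\sum_x F (h x).1); last by apply: eq_bigr.
rewrite -(reindex_inj (inv_inj hK) (P := xpredT) (F := fun x => F x.1)).
rewrite -(pair_big xpredT xpredT (fun f _ => F f)) /=.
rewrite mulr_sumr; apply: eq_bigr => f _.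
by rewrite sumr_const mulr_natl.
Qed.

Definition set_coord (R : realType) (n : nat) (v : 'cV[R]_n) (j : 'I_n) (t : R) :=
  \col_i (if i == j then t else v i 0).

(** Convexity along the axes is what slicing uses: it makes every slice an interval. *)
Definition coord_convex (R : realType) (n : nat) (K : pred 'cV[R]_n) :=
  forall v j t1 t2 t, K (set_coord v j t1) -> K (set_coord v j t2) ->
    t1 <= t <= t2 -> K (set_coord v j t).

Definition grid (R : realType) (n c : nat) (m : 'I_n -> nat)
    (f : {ffun 'I_n -> 'I_c.*2.+1}) : 'cV[R]_n :=
  \col_i grid_point R c (m i) (f i).

Definition box_mass (R : realType) (n c : nat) (m : 'I_n -> nat)
    (K : pred 'cV[R]_n) : R :=
  (\prod_i (m i)%:R^-1) *
  \sum_(f : {ffun 'I_n -> 'I_c.*2.+1}) (K (grid R m f))%:R.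
Arguments box_mass {R n} c m K.

Lemma grid_mass_le1 (R : realType) (c m : nat) (J : pred R) (x L : R) :
  (0 < m)%N -> 0 <= L -> (forall t, J t -> x <= t <= x + L) ->
  grid_mass c m J <= L + 1.
Proof.
move=> m0 L0 Jx; apply: (le_trans (grid_mass_le c m0 _ Jx)); first by lra.
have : m%:R^-1 <= 1 :> R by rewrite invf_le1 ?ler1n ?ltr0n.
by lra.
Qed.

Lemma grid_mass_ge0 (R : realType) (c m : nat) (J : pred R) : 0 <= grid_mass c m J.
Proof. by rewrite mulr_ge0 ?invr_ge0 ?sumr_ge0. Qed.

Lemma box_mass_prod (R : realType) (n c : nat) (m : 'I_n -> nat)
    (J : 'I_n -> pred R) (K : pred 'cV[R]_n) :
  (forall v, K v = [forall i, J i (v i 0)]) ->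
  box_mass c m K = \prod_i grid_mass c (m i) (J i).
Proof.
move=> KJ; rewrite /box_mass /grid_mass big_split /= bigA_distr_bigA /=.
congr (_ * _); apply: eq_bigr => f _; rewrite KJ.
have [/forallP a|/forallPn[i nJ]] := boolP [forall i, J i (grid R m f i 0)].
  rewrite big1 // => i _; have := a i; rewrite mxE => ->; by [].
rewrite (bigD1 i) //=; move: nJ; rewrite mxE => /negbTE ->.
by rewrite mul0r.
Qed.

Lemma box_mass_le (R : realType) (n c : nat) (m : 'I_n -> nat)
    (K : pred 'cV[R]_n) (x : 'I_n -> R) (L : R) :
  (forall i, 0 < m i)%N -> 0 <= L ->
  (forall v, K v -> forall i, x i <= v i 0 <= x i + L) ->
  box_mass c m K <= (L + 1) ^+ n.
Proof.
move=> m0 L0 Kx.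
pose J i := [pred t | x i <= t <= x i + L].
pose K' (v : 'cV[R]_n) := [forall i, J i (v i 0)].
apply: (@le_trans _ _ (box_mass c m K')).
  apply: ler_wpM2l; first by apply: prodr_ge0 => i _; rewrite invr_ge0.
  apply: ler_sum => f _; case: (boolP (K _)) => // Kf.
  by rewrite (_ : K' _ = true) //; apply/forallP => i; exact: Kx.
rewrite (box_mass_prod _ _ (J := J)) // -[leRHS](_ : \prod_(i < n) (L + 1) = _).
  apply: ler_prod => i _; rewrite grid_mass_ge0 /=.
  exact: (@grid_mass_le1 _ _ _ _ (x i)).
by rewrite prodr_const card_ord.
Qed.

(** Each slice along the axis [j] is an interval, so its masses for the two steps both lie within 1
    of its length. Slices that meet [K] have their base points in a box of side [L] in the other
    [n - 1] coordinates, and such points have total mass at most [(L + 1) ^+ n.-1]. *)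
Lemma box_mass_step (R : realType) (n c : nat) (m m' : 'I_n -> nat) (j : 'I_n)
    (K : pred 'cV[R]_n) (x : 'I_n -> R) (L B : R) :
  (forall i, 0 < m i)%N -> (forall i, 0 < m' i)%N ->
  (forall i, i != j -> m i = m' i) -> 0 <= L ->
  (m j)%:R * B <= c%:R -> (m' j)%:R * B <= c%:R ->
  coord_convex K -> (forall v, K v -> forall i, `|v i 0| <= B) ->
  (forall v, K v -> forall i, x i <= v i 0 <= x i + L) ->
  `|box_mass c m K - box_mass c m' K| <= 2 * (L + 1) ^+ n.-1.
Proof.
move=> m0 m0' mm' L0 cB cB' Kc KB Kx.
pose N := c.*2.+1.
pose P : R := \prod_(i | i != j) (m i)%:R^-1.
have P0 : 0 <= P by rewrite prodr_ge0 // => i _; rewrite invr_ge0.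
pose fib (f : {ffun 'I_n -> 'I_N}) t := K (set_coord (grid R m f) j t).
have E mm : (forall i, i != j -> m i = mm i) ->
    N%:R * box_mass c mm K = P * \sum_f grid_mass c (mm j) (fib f).
  move=> mmm; rewrite /box_mass mulrCA -[N in N%:R]card_ord.
  rewrite (sum_ffun_update _ j) (bigD1 j) //= mulrAC mulrC.
  congr (_ * _); first by apply: eq_bigr => i ij; rewrite mmm.
  rewrite mulr_sumr; apply: eq_bigr => f _.
  congr (_ * _); apply: eq_bigr => k _; congr (K _)%:R.
  apply/colP => i; rewrite !mxE ffunE.
  by case: eqP => [->//|/eqP ij]; rewrite mmm.
(* The condition at [j] is vacuous, so the product of these indicators tests whether the base point
   of the slice lies in the projected box. *)
pose J i : pred R := [pred t | (i == j) || (x i <= t <= x i + L)].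
have N0 : 0 < N%:R :> R by rewrite ltr0n.
rewrite -(ler_pM2l N0) -{1}[N%:R]gtr0_norm // -normrM mulrBr.
rewrite (E m) // (E m') // -mulrBr normrM (ger0_norm P0) -sumrB.
apply: (@le_trans _ _ (P * \sum_(f : {ffun 'I_n -> 'I_N}) 2 *
    \prod_i (J i (grid_point R c (m i) (f i)))%:R)).
  rewrite ler_wpM2l //; apply: le_trans (ler_norm_sum _ _ _) _.
  apply: ler_sum => f _.
  have [/forallP a|/forallPn[i nJ]] :=
      boolP [forall i, J i (grid_point R c (m i) (f i))].
    rewrite big1 => [|i _]; last by rewrite a.
    have [||l hl] := @grid_mass_convex R (fib f) B.
    - by move=> t /KB /(_ j); rewrite mxE eqxx.
    - by move=> t1 t2 t; exact: Kc.
    have inv1 k : (0 < k)%N -> k%:R^-1 <= 1 :> R.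
      by move=> k0; rewrite invf_le1 ?ler1n ?ltr0n.
    have := le_trans (hl _ _ (m0 j) cB) (inv1 _ (m0 j)).
    have := le_trans (hl _ _ (m0' j) cB') (inv1 _ (m0' j)).
    by rewrite !ler_norml => /andP[? ?] /andP[? ?]; apply/andP; split; lra.
  have fib0 t : fib f t = false.
    apply/negbTE/negP => /Kx /(_ i); rewrite !mxE.
    by move: nJ; rewrite /= negb_or => /andP[/negbTE -> /negP].
  have gm0 k : grid_mass c k (fib f) = 0.
    by rewrite /grid_mass big1 ?mulr0 // => k' _; rewrite fib0.
  rewrite !gm0 subrr normr0 mulr_ge0 // prodr_ge0 // => i' _.
rewrite -mulr_sumr -(bigA_distr_bigA (fun i (k : 'I_N) =>
  (J i (grid_point R c (m i) k))%:R)) /= (bigD1 j) //=.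
rewrite (eq_bigr (fun=> 1)) => [|k _]; last by rewrite /J /= eqxx.
rewrite sumr_const card_ord.
set S := \prod_(i | i != j) _.
have PS : P * S <= (L + 1) ^+ n.-1.
  rewrite -big_split /= -[leRHS](_ : \prod_(i < n | i != j) (L + 1) = _).
    apply: ler_prod => i ij.
    rewrite -[X in 0 <= X <= _]/(grid_mass c (m i) (J i)) grid_mass_ge0 /=.
    by apply: (@grid_mass_le1 _ _ _ _ (x i)) => // t; rewrite /J /= (negbTE ij).
  by rewrite prodr_const cardC1 card_ord.
rewrite (_ : _ * _ = N%:R * (2 * (P * S))); last by ring.
by rewrite !ler_pM2l.
Qed.

(* The steps are changed from 1 to 1/m one coordinate at a time. *)
Lemma box_mass_compare (R : realType) (n c m : nat)
    (K : pred 'cV[R]_n) (x : 'I_n -> R) (L B : R) :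
  (0 < m)%N -> 0 <= L -> B <= c%:R -> m%:R * B <= c%:R ->
  coord_convex K -> (forall v, K v -> forall i, `|v i 0| <= B) ->
  (forall v, K v -> forall i, x i <= v i 0 <= x i + L) ->
  `|box_mass c (fun=> 1%N) K - box_mass c (fun=> m) K|
    <= n%:R * (2 * (L + 1) ^+ n.-1).
Proof.
move=> m0 L0 cB cmB Kc KB Kx.
pose st k (i : 'I_n) := if (i < k)%N then m else 1%N.
have st0 k i : (0 < st k i)%N by rewrite /st; case: ifP.
have stB k i : (st k i)%:R * B <= c%:R by rewrite /st; case: ifP; rewrite ?mul1r.
have e0 : box_mass c (fun=> 1%N) K = box_mass c (st 0%N) K.
  by [].
have e1 : box_mass c (fun=> m) K = box_mass c (st n) K.
  by congr (box_mass c _ K); apply/funext => i; rewrite /st ltn_ord.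
rewrite e0 e1 distrC.
rewrite -(telescope_sumr (fun k => box_mass c (st k) K)) // big_mkord.
apply: le_trans (ler_norm_sum _ _ _) _.
rewrite -[n%:R * _](_ : \sum_(k < n) (2 * (L + 1) ^+ n.-1) = _); last first.
  by rewrite sumr_const card_ord -[LHS]mulr_natl.
apply: ler_sum => k _; apply: (box_mass_step (j := k) (x := x) (B := B)) => //.
move=> i ik; rewrite /st ltnS leq_eqVlt.
by case: eqP => // ik'; case/eqP: ik; apply: val_inj.
Qed.

(** * Reduced bases *)

Definition dotp (R : realType) (n : nat) (v w : 'cV[R]_n) : R := (v^T *m w) 0 0.
Definition sqnorm (R : realType) (n : nat) (v : 'cV[R]_n) : R := dotp v v.

Lemma sqnormE (R : realType) (n : nat) (v : 'cV[R]_n) :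
  sqnorm v = \sum_i v i 0 ^+ 2.
Proof. by rewrite /sqnorm /dotp mxE; apply: eq_bigr => i _; rewrite mxE expr2. Qed.

Lemma sqnorm_ge0 (R : realType) (n : nat) (v : 'cV[R]_n) : 0 <= sqnorm v.
Proof. by rewrite sqnormE sumr_ge0 // => i _; rewrite sqr_ge0. Qed.

Lemma euclidean_normE (R : realType) (n : nat) (v : 'cV[R]_n) :
  euclidean_norm v = Num.sqrt (sqnorm v).
Proof. by rewrite /euclidean_norm sqnormE. Qed.

Lemma dotpC (R : realType) (n : nat) (v w : 'cV[R]_n) : dotp v w = dotp w v.
Proof. by rewrite /dotp !mxE; apply: eq_bigr => i _; rewrite !mxE mulrC. Qed.

Lemma sqnorm_pythagoras (R : realType) (n : nat) (v w : 'cV[R]_n) (t : R) :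
  dotp v w = 0 -> sqnorm (t *: v + w) = t ^+ 2 * sqnorm v + sqnorm w.
Proof.
move=> vw; have := vw; rewrite dotpC; move: vw; rewrite /sqnorm /dotp => vw wv.
have -> : (t *: v + w)^T = t *: v^T + w^T by rewrite linearD linearZ.
rewrite mulmxDl !mulmxDr -!scalemxAl -!scalemxAr.
rewrite !mxE; move: vw wv; rewrite !mxE => -> ->; ring.
Qed.

(** A positive infimum [inf E] has an element of [E] below [2 * inf E]. This replaces the existence
    of a shortest lattice vector, which would call for a discreteness argument. *)
Lemma near_minimum (R : realType) (T : Type) (P : T -> Prop) (f : T -> R) (l : R) :
  0 < l -> (exists x, P x) -> (forall x, P x -> l <= f x) ->
  exists2 x, P x & forall y, P y -> f x <= 2 * f y.
Proof.
move=> l0 [x0 Px0] fl; pose E := [set f x | x in [set x | P x]].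
have E0 : E !=set0 by exists (f x0); exists x0.
have lE : l <= inf E by apply: lb_le_inf => // _ [x /fl ? <-].
have hE : has_inf E by split=> //; exists l => _ [x /fl ? <-].
have [_ [x Px <-] fx] := inf_adherent (lt_le_trans l0 lE) hE.
exists x => // y Py.
have : inf E <= f y by apply: ge_inf; [case: hE|exists y].
lra.
Qed.

Lemma round_exists (R : realType) (t : R) :
  exists k : int, `|t - k%:~R| <= 1 / 2.
Proof.
exists (Num.floor (t + 1 / 2)).
have /andP[h1] := floor_itv (t + 1 / 2); rewrite intrD => h2.
by rewrite ler_norml; apply/andP; split; lra.
Qed.

(** This is the Smith normal form of a single column, whose right factor is a 1 by 1 unit: a
    primitive vector extends to a basis of the lattice, namely the columns of [L]. *)
Lemma primitive_column (n : nat) (x : 'cV[int]_(1 + n)) : x != 0 ->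
  exists (L L' : 'M[int]_(1 + n)) (g : int),
    [/\ L *m L' = 1%:M, L' *m L = 1%:M, g != 0 & x = g *: lsubmx L].
Proof.
move=> x0; have [L Lu [Q Qu [d _ xE]]] := int_Smith_normal_form x.
exists L, (invmx L), (d`_0 * Q 0 0).
have xg : x = (d`_0 * Q 0 0) *: lsubmx L.
  rewrite [LHS]xE; apply/matrixP => i j; rewrite (ord1 j) mxE big_ord1 !mxE.
  rewrite (bigD1 0) //= big1 => [|k k0]; last first.
    by rewrite !mxE (negbTE k0 : (k == 0%N :> nat) = false) mulr0n mulr0.
  rewrite !mxE /= addr0 mulr1n [RHS]mulrC mulrA.
  by congr (L _ _ * _ * _); apply: val_inj.
split; rewrite ?mulmxV ?mulVmx //.
by apply: contraNneq x0 => g0; rewrite xg g0 scale0r.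
Qed.

(* Induction on n: split off a vector a of almost minimal length, project along
   it, and note that the projected lattice has minimum at least l / 2.  The
   functionals of the projection are the last coordinates; the first one is
   corrected by an integral combination of these, with real coefficients
   rounded to [c]. *)
Lemma dual_reduced_basis_sq (R : realType) (n : nat) : exists2 C : R, 0 < C &
  forall (k : nat) (A : 'M[R]_(k, n)) (l : R), 0 < l ->
    (forall x : 'cV[int]_n, x != 0 -> l <= sqnorm (A *m map_mx intr x)) ->
  exists U V : 'M[int]_n, [/\ U *m V = 1%:M, V *m U = 1%:M &
    forall (x : 'cV[R]_n) i,
      `|(map_mx intr V *m x) i 0| <= C * Num.sqrt (sqnorm (A *m x) / l)].
Proof.
elim: n => [|n [C C0 IH]].
  exists 1 => // k A l _ _; exists 1%:M, 1%:M.
  by split; rewrite ?mulmx1 // => x [].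
(* The 1 bounds the component along [a], and [2 * C] each coordinate of the projection; [n] of these
   enter the first coordinate, multiplied by rounding errors. *)
exists (1 + 2 * C * n.+1%:R) => [|k A l l0 Al].
  by rewrite addr_gt0 // !mulr_gt0.
have [||x0 x0n x0min] := @near_minimum R 'cV[int]_(1 + n) (fun x => x != 0)
    (fun x => sqnorm (A *m map_mx intr x)) l l0.
- exists (const_mx 1); apply/negP => /eqP/matrixP /(_ 0 0).
  by rewrite !mxE.
- exact: Al.
have [L [L' [g [LL' L'L g0 x0E]]]] := primitive_column x0n.
have [a adef] : {a : 'cV[R]_k | a = A *m map_mx intr (lsubmx L)} by eexists.
have [A' A'def] : {A' : 'M[R]_(k, n) | A' = A *m map_mx intr (rsubmx L)} by eexists.
have b0 : lsubmx L != 0 by apply: contraNneq x0n => b0; rewrite x0E b0 scaler0.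
have al : l <= sqnorm a by rewrite adef; exact: Al.
have a0 : 0 < sqnorm a by apply: lt_le_trans al.
(* The vector [a] is the image of [x0] divided by the nonzero integer [g], so it is no longer than
   that image and inherits the almost minimality. *)
have amin y : y != 0 -> sqnorm a <= 2 * sqnorm (A *m map_mx intr y).
  move=> /x0min; apply: le_trans.
  rewrite x0E map_mxZ -scalemxAr -adef.
  rewrite -[_ *: a]addr0 sqnorm_pythagoras; last first.
    by rewrite /dotp mulmx0 mxE.
  rewrite [sqnorm 0]/sqnorm /dotp mulmx0 mxE addr0 ler_peMl ?(ltW a0) //.
  by rewrite -rmorphXn /= ler1z -gtz0_ge1 lt0r sqr_ge0 expf_neq0.
have LE : L = row_mx (lsubmx L) (rsubmx L) by rewrite hsubmxK.
(* [tau] holds the Gram-Schmidt coefficients along [a], and the columns of [A2] are those of [A']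
   projected orthogonally to [a]. *)
pose tau : 'rV[R]_n := (sqnorm a)^-1 *: (a^T *m A').
pose A2 := A' - a *m tau.
have orth y : dotp a (A2 *m y) = 0.
  rewrite /dotp mulmxA /A2 mulmxBr [a^T *m (a *m _)]mulmxA [a^T *m a]mx11_scalar.
  rewrite -[X in X%:M]/(sqnorm a) mul_scalar_mx /tau scalerA mulfV ?gt_eqF //.
  by rewrite scale1r subrr mul0mx mxE.
have A'E y : A' *m y = (tau *m y) 0 0 *: a + A2 *m y.
  rewrite -mul_mx_scalar -mx11_scalar /A2 mulmxBl -mulmxA.
  by rewrite addrC subrK.
(* The lift [w] of [y] has a coefficient of at most 1/2 along [a]. With [q = sqnorm (A2 *m z)],
   almost minimality gives [sqnorm a <= sqnorm a / 2 + 2 q], hence [sqnorm a <= 4 q], and then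
   [l <= sqnorm a / 4 + q <= 2 q]. *)
have A2l (y : 'cV[int]_n) : y != 0 -> l / 2 <= sqnorm (A2 *m map_mx intr y).
  move=> y0; set z := map_mx intr y.
  have [j jt] := round_exists ((tau *m z) 0 0).
  pose w := L *m (col_mx (- j)%:M y : 'cV_(1 + n)).
  have w0 : w != 0.
    apply: contraNneq y0 => w0; have : L' *m w = 0 by rewrite w0 mulmx0.
    rewrite mulmxA L'L mul1mx => /eqP; rewrite -[0]col_mx0 => /eqP/eq_col_mx.
    by case=> _ ->.
  have Aw : A *m map_mx intr w = ((tau *m z) 0 0 - j%:~R) *: a + A2 *m z.
    rewrite /w LE mul_row_col map_mxD !map_mxM mulmxDr.
    rewrite !mulmxA -adef -A'def A'E map_scalar_mx mul_mx_scalar addrA -scalerDl.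
    by rewrite rmorphN /= [- _ + _]addrC.
  have := Al _ w0; have := amin _ w0; rewrite Aw sqnorm_pythagoras // => h1 h2.
  have : (((tau *m z) 0 0 - j%:~R) ^+ 2) * sqnorm a <= 1 / 4 * sqnorm a.
    rewrite ler_pM2r // -real_normK ?num_real //.
    by rewrite -[1 / 4](_ : (1 / 2) ^+ 2 = _); [rewrite lerXn2r ?nnegrE|field].
  lra.
have [U' [V' [UV' VU' V'A]]] := IH k A2 (l / 2) (divr_gt0 l0 (ltr0Sn R 1)) A2l.

pose T := tau *m map_mx intr U'.
have [c hc] : exists c : 'rV[int]_n, forall i, `|T 0 i - (c 0 i)%:~R| <= 1 / 2.
  have [f hf] := choice (fun i => round_exists (T 0 i)).
  by exists (\row_i f i) => i; rewrite mxE.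
(* Size reduction: subtracting [c] times the first basis vector from the others leaves them the
   coefficients [T - c] along [a], at most 1/2 in absolute value. *)
pose Bu : 'M[int]_(1 + n) := block_mx 1%:M (- c) 0 U'.
pose Bv : 'M[int]_(1 + n) := block_mx 1%:M (c *m V') 0 V'.
have BuBv : Bu *m Bv = 1%:M.
  rewrite mulmx_block !mul0mx !mulmx0 !mul1mx mulNmx subrr addr0 !add0r UV'.
  by rewrite -scalar_mx_block.
have BvBu : Bv *m Bu = 1%:M.
  rewrite mulmx_block !mul0mx !mulmx0 !mul1mx -mulmxA VU' mulmx1 addNr addr0 !add0r.
  by rewrite -scalar_mx_block.
exists (L *m Bu), (Bv *m L'); split=> [||x i].
- by rewrite -mulmxA [Bu *m _]mulmxA BuBv mul1mx LL'.
- by rewrite -mulmxA [L' *m _]mulmxA L'L mul1mx BvBu.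
have [s [y sy]] : exists s y, map_mx intr L' *m x = col_mx s%:M y :> 'cV[R]_(1 + n).
  exists (usubmx (map_mx intr L' *m x : 'cV_(1 + n)) 0 0).
  exists (dsubmx (map_mx intr L' *m x : 'cV_(1 + n))).
  by rewrite -mx11_scalar vsubmxK.
have xE : x = map_mx intr L *m col_mx s%:M y.
  by rewrite -sy mulmxA -map_mxM LL' map_scalar_mx mul1mx.
have qx : sqnorm (A *m x) = (s + (tau *m y) 0 0) ^+ 2 * sqnorm a + sqnorm (A2 *m y).
  rewrite -sqnorm_pythagoras //; congr sqnorm.
  rewrite xE LE map_row_mx mul_row_col mulmxDr.
  by rewrite !mulmxA -adef -A'def A'E mul_mx_scalar addrA scalerDl.
set rho := Num.sqrt (sqnorm (A *m x) / l).
have rho0 : 0 <= rho by exact: sqrtr_ge0.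
(* Passing from [l] to [l / 2] costs a factor sqrt 2, which is bounded by 2. *)
have V'y j : `|(map_mx intr V' *m y) j 0| <= 2 * C * rho.
  apply: le_trans (V'A y j) _; rewrite [2 * C]mulrC -mulrA ler_pM2l //.
  rewrite -[2 in leRHS]ger0_norm // -sqrtr_sqr -sqrtrM ?sqr_ge0 //.
  rewrite ler_sqrt ?mulr_ge0 ?sqr_ge0 ?divr_ge0 ?sqnorm_ge0 ?invr_ge0 ?(ltW l0) //.
  rewrite invf_div !mulrA ler_pM2r ?invr_gt0 //.
  have := sqnorm_ge0 (A2 *m y); have := sqnorm_ge0 a.
  have := sqr_ge0 (s + (tau *m y) 0 0); rewrite qx => h1 h2 h3.
  have := mulr_ge0 h1 h2; lra.
have sty : `|s + (tau *m y) 0 0| <= rho.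
  rewrite -sqrtr_sqr ler_sqrt ?divr_ge0 ?sqnorm_ge0 ?invr_ge0 ?(ltW l0) //.
  rewrite ler_pdivlMr // qx.
  apply: (@le_trans _ _ ((s + (tau *m y) 0 0) ^+ 2 * sqnorm a)).
    by rewrite ler_wpM2l ?sqr_ge0.
  by rewrite lerDl sqnorm_ge0.
rewrite map_mxM -mulmxA sy.
have -> : map_mx intr Bv *m col_mx s%:M y =
    col_mx (s%:M + map_mx intr (c *m V') *m y) (map_mx intr V' *m y) :> 'cV[R]_(1 + n).
  rewrite map_block_mx mul_block_col map_scalar_mx mul1mx.
  by rewrite map_const_mx /= mul0mx add0r.
have nC : 2 * C * rho <= (1 + 2 * C * n.+1%:R) * rho.
  rewrite ler_wpM2r // -[n.+1%:R]natr1; have := mulr_ge0 (ltW C0) (ler0n R n).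
  lra.
case: (@split_ordP 1 n i) => j ->; last first.
  rewrite (col_mxEd (s%:M + map_mx intr (c *m V') *m y) (map_mx intr V' *m y) j 0).
  exact: le_trans (V'y j) _.
rewrite (col_mxEu (s%:M + map_mx intr (c *m V') *m y) (map_mx intr V' *m y) j 0).
rewrite (ord1 j) mxE map_mxM -mulmxA.
set z := map_mx intr V' *m y in V'y *.
have tz : (tau *m y) 0 0 = (T *m z) 0 0.
  by rewrite /T /z mulmxA -[tau *m _ *m _]mulmxA -map_mxM UV' map_mx1 mulmx1.
(* The first coordinate is the coefficient along [a] up to the rounding errors; the former is
   bounded by [rho]. *)
have -> : (s%:M : 'M[R]_1) 0 0 + (map_mx intr c *m z) 0 0 =
    (s + (tau *m y) 0 0) - \sum_j (T 0 j - (c 0 j)%:~R) * z j 0.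
  clearbody T z; rewrite tz [s%:M 0 0]mxE [(T *m z) 0 0]mxE [(_ *m z) 0 0]mxE.
  rewrite eqxx mulr1n -addrA -sumrB; congr (_ + _); apply: eq_bigr => j' _.
  rewrite !mxE; ring.
apply: le_trans (ler_normB _ _) _.
apply: (@le_trans _ _ (rho + \sum_(j < n) 2 * C * rho)).
  apply: lerD => //; apply: le_trans (ler_norm_sum _ _ _) _.
  apply: ler_sum => j' _; rewrite normrM.
  apply: (@le_trans _ _ (1 * (2 * C * rho))); last by rewrite mul1r.
  apply: ler_pM => //; apply: le_trans (hc j') _; lra.
rewrite sumr_const card_ord -[(_ *+ n)]mulr_natr -[n.+1%:R]natr1.
have := mulr_ge0 (ltW C0) rho0; lra.
Qed.

Lemma dual_reduced_basis (R : realType) (n : nat) : exists2 C : R, 0 < C &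
  forall (k : nat) (A : 'M[R]_(k, n)) (l : R), 0 < l ->
    (forall x : 'cV[int]_n, x != 0 -> l <= euclidean_norm (A *m real_vec R x)) ->
  exists U V : 'M[int]_n, [/\ U *m V = 1%:M, V *m U = 1%:M &
    forall (x : 'cV[R]_n) i,
      `|(map_mx intr V *m x) i 0| <= C * (euclidean_norm (A *m x) / l)].
Proof.
have [C C0 HC] := dual_reduced_basis_sq R n; exists C => // k A l l0 Al.
have [|x x0|U [V [UV VU VA]]] := HC k A (l ^+ 2); first by rewrite exprn_gt0.
  rewrite -(ler_sqrt _ (sqnorm_ge0 _)) sqrtr_sqr gtr0_norm // -euclidean_normE.
  exact: Al.
exists U, V; split=> // x i; apply: le_trans (VA x i) _.
rewrite ler_pM2l // sqrtrM ?sqnorm_ge0 // -euclidean_normE.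
by rewrite sqrtrV ?exprn_ge0 ?sqrtr_sqr ?gtr0_norm // ltW.
Qed.

(** * Moebius function, zeta, and squarefree divisors *)

Definition mobius (d : nat) : int :=
  \prod_(p <- primes d) (if (p ^ 2 %| d)%N then 0 else -1).

Lemma mobius_norm (d : nat) : `|mobius d| <= 1.
Proof.
rewrite /mobius normr_prod; apply: prodr_ile1 => p _.
by case: ifP; rewrite normr_ge0 ?normr0 ?normrN1.
Qed.

Lemma mobius_eq0 (d p : nat) : (0 < d)%N -> prime p -> (p ^ 2 %| d)%N -> mobius d = 0.
Proof.
move=> d0 pp pd; apply/eqP; rewrite prodf_seq_eq0; apply/hasP; exists p => /=.
  by rewrite mem_primes pp d0 (dvdn_trans _ pd) // expnS dvdn_mulr.
by rewrite pd.
Qed.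

Lemma mobius_prime_mul (p e : nat) : prime p -> (0 < e)%N -> ~~ (p %| e)%N ->
  mobius (p * e) = - mobius e.
Proof.
move=> pp e0 pe; have pe1 : perm_eq (primes (p * e)) (p :: primes e).
  apply: uniq_perm; rewrite ?primes_uniq //=.
    by rewrite primes_uniq andbT mem_primes pp e0.
  move=> q; rewrite primesM ?(prime_gt0 pp) ?e0 // primes_prime // !inE.
  by [].
rewrite /mobius (perm_big _ pe1) big_cons /=.
rewrite expnS dvdn_pmul2l ?prime_gt0 // expn1 (negbTE pe) mulN1r; congr (- _).
apply: eq_big_seq => q; rewrite mem_primes => /and3P[qp _ qe].
rewrite Gauss_dvdr // coprime_pexpl // prime_coprime //.
by apply: contra pe; rewrite dvdn_prime2 // => /eqP <-.
Qed.

Lemma sum_mobius_dvd (g N : nat) : (0 < g)%N -> (g < N)%N ->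
  \sum_(1 <= d < N | (d %| g)%N) mobius d = (g == 1%N)%:R.
Proof.
move=> g0 gN.
have -> : \sum_(1 <= d < N | (d %| g)%N) mobius d = \sum_(d < N | (d %| g)%N) mobius d.
  rewrite -(big_mkord (fun d => d %| g)%N) /= [RHS](big_ltn_cond) ?(ltn_trans g0) //.
  by rewrite dvd0n (gtn_eqF g0).
have [->|g1] := eqVneq g 1%N.
  rewrite (bigD1 (Ordinal (leq_ltn_trans g0 gN))) //= big1 ?addr0.
    by rewrite /mobius /= big_nil.
  move=> d /andP[]; rewrite dvdn1 => /eqP d1 /eqP []; exact: val_inj.
have gg1 : (1 < g)%N by rewrite ltn_neqAle eq_sym g1.
(* Squarefree divisors are paired as e, p e for a fixed prime p of g. *)
set p := pdiv g; have pp : prime p by exact: pdiv_prime.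
have pg : (p %| g)%N by exact: pdiv_dvd.
rewrite (bigID (fun d : 'I_N => (p %| d)%N)) /=.
rewrite (bigID (fun d : 'I_N => (p ^ 2 %| d)%N)) /= big1 ?add0r; last first.
  move=> d /andP[/andP[dg _] p2d]; apply: (mobius_eq0 _ pp p2d).
  by case: (nat_of_ord d) dg => //; rewrite dvd0n (gtn_eqF g0).
case: N gN => // N gN.
pose h (e : 'I_N.+1) : 'I_N.+1 := inord (p * e).
pose h' (d : 'I_N.+1) : 'I_N.+1 := inord (d %/ p).
have dN d : (d %| g)%N -> (d < N.+1)%N.
  by move=> /(dvdn_leq g0) dg; apply: leq_ltn_trans dg gN.
rewrite (reindex_onto h h') /=; last first.
  move=> d /andP[/andP[dg pd] _]; rewrite /h /h'.
  have lt : (d %/ p < N.+1)%N by apply: leq_ltn_trans (leq_div _ _) (ltn_ord d).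
  by rewrite (inordK lt) mulnC divnK // inord_val.
rewrite (eq_bigl (fun e : 'I_N.+1 => (e %| g)%N && ~~ (p %| e)%N)); last first.
  move=> e /=; rewrite /h /h'.
  apply/idP/idP => [/andP[/andP[/andP[]]]|/andP[eg pe]].
    have [peN|peN] := ltnP (p * e) N.+1.
      rewrite inordK // => peg _ p2 _.
      rewrite (dvdn_trans (dvdn_mull _ (dvdnn _)) peg) /=.
      by move: p2; rewrite expnS dvdn_pmul2l ?prime_gt0 // expn1.
    by rewrite {1}/inord val_insubd ltnNge peN /= dvd0n (gtn_eqF g0).
  have peg : (p * e %| g)%N.
    by rewrite Gauss_dvd ?pg // prime_coprime.
  rewrite inordK ?dN // peg dvdn_mulr //= expnS dvdn_pmul2l ?prime_gt0 // expn1 pe /=.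
  by rewrite mulKn ?prime_gt0 // inord_val.
rewrite -big_split /= big1 ?(negbTE g1) // => e /andP[eg pe].
have e0 : (0 < e)%N by case: (nat_of_ord e) eg => //; rewrite dvd0n (gtn_eqF g0).
rewrite /h inordK ?mobius_prime_mul ?addNr //.
by apply: dN; rewrite Gauss_dvd ?pg // prime_coprime.
Qed.

Lemma sum_multiples (V : nmodType) (f : nat -> V) (d D : nat) : (0 < d)%N ->
  \sum_(1 <= m < D.+1 | (d %| m)%N) f m = \sum_(1 <= k < (D %/ d).+1) f (d * k)%N.
Proof.
move=> d0; elim: D => [|D IH]; first by rewrite div0n !big_geq.
rewrite big_mkcond big_nat_recr //= -big_mkcond IH divnS //.
case: ifP => dD; rewrite ?addn0 ?add0n ?addr0 //.
rewrite add1n [RHS]big_nat_recr //=; congr (_ + f _).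
have := divnK dD; rewrite divnS // dD add1n mulnC; by [].
Qed.

Lemma logn_sqfree (p d : nat) : prime p -> (0 < d)%N -> mobius d != 0 ->
  logn p d = (p %| d)%N :> nat.
Proof.
move=> pp d0 md; have : ~~ (p ^ 2 %| d)%N.
  by apply: contra md => p2; rewrite (mobius_eq0 d0 pp p2).
rewrite pfactor_dvdn // -ltnNge ltnS -[p in (p %| d)%N]expn1 pfactor_dvdn //.
by case: (logn p d) => [|[]].
Qed.

(** A squarefree divisor of [m] is determined by the set of primes of [m] that divide it. *)
Lemma card_sqfree_divisors (m : nat) : (0 < m)%N ->
  (size [seq d <- divisors m | mobius d != 0] <= 2 ^ size (primes m))%N.
Proof.
move=> m0; pose k := size (primes m).
pose S (d : nat) : {set 'I_k} := finset (fun i : 'I_k => nth 0 (primes m) i %| d)%N.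
set s := [seq _ <- _ | _].
have sP d : d \in s -> [/\ (0 < d)%N, (d %| m)%N & mobius d != 0].
  rewrite mem_filter -dvdn_divisors // => /andP[-> dm].
  by rewrite dm (dvdn_gt0 m0 dm).
have Sinj : {in s &, injective S}.
  move=> d d' /sP[d0 dm md] /sP[d'0 d'm md'] SS.
  apply: (eqn_from_log d0 d'0) => p /=.
  have [pm|pm] := boolP (p \in primes m); last first.
    have l0 e : (e %| m)%N -> logn p e = 0%N.
      move=> em; have := dvdn_leq_log p m0 em.
      by move: pm; rewrite -logn_gt0 lt0n negbK => /eqP ->; rewrite leqn0 => /eqP.
    by rewrite !l0.
  have pp : prime p by move: pm; rewrite mem_primes => /andP[].
  rewrite !logn_sqfree //; congr nat_of_bool.
  have ik : (index p (primes m) < k)%N by rewrite index_mem.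
  have : (Ordinal ik \in S d) = (Ordinal ik \in S d') by rewrite SS.
  by rewrite !inE /= nth_index.
have us : uniq [seq S d | d <- s].
  by rewrite map_inj_in_uniq // filter_uniq // divisors_uniq.
rewrite -(size_map S) -(card_uniqP us) (leq_trans (max_card _)) //.
have := card_powerset (finset.setT : {set 'I_k}).
rewrite cardsT card_ord => <-; apply: subset_leq_card; apply/fintype.subsetP => A _.
by rewrite powersetE finset.subsetT.
Qed.

(** At most [Y] primes lie below [Y], and if [k] primes of [m] are at least [Y], then [Y ^ k <= m].
    Later [Y] is about a power of [log delta] with exponent below 1, which makes the second term
    dominate without any information on the distribution of primes. *)
Lemma num_primes_le (R : realType) (m Y : nat) : (0 < m)%N -> (1 < Y)%N ->
  (size (primes m))%:R <= Y%:R + ln m%:R / ln Y%:R :> R.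
Proof.
move=> m0 Y1.
have lY : 0 < ln Y%:R :> R by rewrite ln_gt0 // ltr1n.
rewrite -(count_predC (fun p => p < Y)%N) natrD; apply: lerD.
  rewrite ler_nat -size_filter -[leqRHS](size_iota 0).
  apply: uniq_leq_size; first by rewrite filter_uniq ?primes_uniq.
  by move=> p; rewrite mem_filter mem_iota /= add0n => /andP[].
set k := count _ _; rewrite ler_pdivlMr // mulr_natl -lnXn ?ltr0n ?(ltnW Y1) //.
rewrite ler_ln ?posrE ?exprn_gt0 ?ltr0n ?(ltnW Y1) // -natrX ler_nat.
rewrite [leqRHS](prod_prime_decomp m0) prime_decompE big_map /=.
rewrite (bigID (fun p => p < Y)%N) /= -[leqLHS]mul1n; apply: leq_mul.
  by rewrite big_seq_cond prodn_cond_gt0.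
rewrite /k -big_filter -size_filter; set s := [seq _ <- _ | _].
have : all (fun p => (Y <= p) && (0 < logn p m))%N s.
  apply/allP => p; rewrite mem_filter /= -leqNgt => /andP[-> pm] /=.
  by rewrite logn_gt0.
elim: s => [_|p s IH /= /andP[/andP[Yp lp] /IH]]; first by rewrite big_nil.
rewrite big_cons expnS => h; apply: leq_mul h.
rewrite (leq_trans Yp) // -{1}[p]expn1 leq_pexp2l //.
by rewrite (leq_trans _ Yp) // ltnW.
Qed.

(** * Partial sums of zeta and the truncated Moebius series *)

Definition zeta_sum (R : realType) (n M : nat) : R :=
  \sum_(1 <= k < M.+1) (k%:R ^+ n)^-1.

Lemma zetaE (R : realType) (n : nat) :
  zeta (n%:R : R) = limn (zeta_sum R n).
Proof.
rewrite /zeta; congr (limn _); apply/funext => N.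
rewrite /series /zeta_sum /= big_add1 /=.
by apply: eq_bigr => k _; rewrite powR_mulrn.
Qed.

Lemma zeta_sum_nondecreasing (R : realType) (n : nat) :
  {homo zeta_sum R n : N M / (N <= M)%N >-> N <= M}.
Proof.
move=> N M NM; rewrite /zeta_sum (@big_cat_nat _ _ _ N.+1 1 M.+1) //= lerDl.
by apply: sumr_ge0 => k _; rewrite invr_ge0 exprn_ge0.
Qed.

(** Beyond [M] a term is at most [M^-n] times [1/(N (N+1))], and these telescope. Writing the
    exponent as [n.+2] encodes that it is at least 2. *)
Lemma zeta_sum_tail (R : realType) (n M j : nat) : (0 < M)%N ->
  zeta_sum R n.+2 (M + j) <= zeta_sum R n.+2 M +
    (M%:R ^+ n)^-1 * (M%:R^-1 - (M + j)%:R^-1).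
Proof.
move=> M0; have MR : 0 < M%:R :> R by rewrite ltr0n.
elim: j => [|j IH]; first by rewrite addn0 subrr mulr0 addr0.
rewrite addnS {1}/zeta_sum big_nat_recr //= -/(zeta_sum R n.+2 (M + j)).
set N := (M + j)%N in IH *.
have NR : M%:R <= N%:R :> R by rewrite ler_nat leq_addr.
have N0 : 0 < N%:R :> R by apply: lt_le_trans NR.
suff : (N.+1%:R ^+ n.+2)^-1 <= (M%:R ^+ n)^-1 * (N%:R^-1 - N.+1%:R^-1) :> R.
  move=> h; apply: le_trans (lerD IH h) _; rewrite -addrA -mulrDr.
  by rewrite addrA subrK.
rewrite -[N.+1%:R]natr1.
have -> : N%:R^-1 - (N%:R + 1)^-1 = (N%:R * (N%:R + 1))^-1 :> R.
  by field; rewrite !gt_eqF //; lra.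
have N1 : 0 < N%:R + 1 :> R by lra.
rewrite -invfM lef_pV2 ?posrE ?(exprn_gt0 n.+2 N1) ?mulr_gt0 ?exprn_gt0 //.
rewrite -[n.+2]addn2 exprD; apply: ler_pM; rewrite ?mulr_ge0 ?exprn_ge0 //.
- by rewrite lerXn2r ?nnegrE ?(ltW N1) ?ler0n //; lra.
- by rewrite expr2 ler_pM2r //; lra.
Qed.

Lemma zeta_sum_le (R : realType) (n M N : nat) : (0 < M)%N ->
  zeta_sum R n.+2 N <= zeta_sum R n.+2 M + (M%:R ^+ n.+1)^-1.
Proof.
move=> M0; have MR : 0 < M%:R :> R by rewrite ltr0n.
apply: le_trans (zeta_sum_nondecreasing _ _ (leq_addl M N)) _.
apply: le_trans (zeta_sum_tail _ _ _ M0) _; rewrite lerD2l exprSr invfM.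
by rewrite ler_pM2l ?invr_gt0 ?exprn_gt0 // gerBl invr_ge0.
Qed.

Lemma zeta_bounds (R : realType) (n M : nat) : (0 < M)%N ->
  zeta_sum R n.+2 M <= zeta (n.+2%:R : R) <= zeta_sum R n.+2 M + (M%:R ^+ n.+1)^-1.
Proof.
move=> M0.
have cv : cvgn (zeta_sum R n.+2).
  apply: nondecreasing_is_cvgn; first exact: zeta_sum_nondecreasing.
  exists (zeta_sum R n.+2 M + (M%:R ^+ n.+1)^-1) => _ [N _ <-].
  exact: zeta_sum_le.
rewrite zetaE; apply/andP; split.
  by apply: nondecreasing_cvgn_le => //; exact: zeta_sum_nondecreasing.
by apply: limr_le => //; near=> N; exact: zeta_sum_le.
Unshelve. all: by end_near. Qed.

Lemma zeta_ge1 (R : realType) (n : nat) : 1 <= zeta (n.+2%:R : R).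
Proof.
have /andP[+ _] := @zeta_bounds R n 1 isT.
by rewrite /zeta_sum big_nat1 expr1n invr1.
Qed.

Lemma harmonic_le_ln (R : realType) (D : nat) :
  \sum_(1 <= d < D.+2) d%:R^-1 <= 1 + ln D.+1%:R :> R.
Proof.
elim: D => [|D IH]; first by rewrite big_nat1 invr1 ln1 addr0.
rewrite big_nat_recr //=.
suff h : D.+2%:R^-1 <= ln D.+2%:R - ln D.+1%:R :> R.
  by apply: le_trans (lerD IH h) _; rewrite -addrA [ln _ + (_ - _)]addrC subrK.
have D1 : 0 < D.+1%:R :> R by rewrite ltr0n.
have D2 : 0 < D.+2%:R :> R by rewrite ltr0n.
rewrite -lerN2 opprB -ln_div ?posrE //.
have -> : D.+1%:R / D.+2%:R = 1 + (- D.+2%:R^-1) :> R.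
  by rewrite -[D.+2%:R]natr1; field; rewrite gt_eqF // natr1.
by apply: le_ln1Dx; rewrite ltrN2 invf_lt1 // ltr1n.
Qed.

(* The product of the two Dirichlet series, truncated along hyperbolas. *)
Lemma sum_mobius_zeta (R : realType) (n D : nat) : (0 < D)%N ->
  \sum_(1 <= d < D.+1) (mobius d)%:~R * (d%:R ^+ n)^-1 * zeta_sum R n (D %/ d) = 1.
Proof.
move=> D0.
transitivity (\sum_(1 <= m < D.+1) \sum_(1 <= d < D.+1 | (d %| m)%N)
    (mobius d)%:~R * (m%:R ^+ n)^-1 : R).
  rewrite (exchange_big_dep_nat xpredT) //=; apply: eq_big_nat => d /andP[d0 _].
  rewrite (sum_multiples (fun m => (mobius d)%:~R * (m%:R ^+ n)^-1)) //.
  rewrite mulr_sumr; apply: eq_bigr => k _.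
  by rewrite natrM exprMn invfM mulrA.
rewrite big_nat_recl // [X in _ + X]big1_seq ?addr0.
  by rewrite -mulr_suml -rmorph_sum /= sum_mobius_dvd // expr1n invr1 mulr1.
move=> m /andP[_]; rewrite mem_index_iota => /andP[m0 mD].
by rewrite -mulr_suml -rmorph_sum /= sum_mobius_dvd // eqSS (gtn_eqF m0) mul0r.
Qed.

(** Multiplication by zeta, which is at least 1, and subtraction of the finite identity
    [sum_mobius_zeta] leave the tails of zeta beyond [D %/ d]. As [D <= 2 d (D %/ d)], each term is
    at most [(2 / D) ^+ n.+1 / d], and the harmonic sum gives the logarithm. *)
Lemma sum_mobius_approx (R : realType) (n D : nat) : (0 < D)%N ->
  `|\sum_(1 <= d < D.+1) (mobius d)%:~R * (d%:R ^+ n.+2)^-1 - (zeta (n.+2%:R : R))^-1|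
    <= 2 ^+ n.+1 * (1 + ln D%:R) / D%:R ^+ n.+1 :> R.
Proof.
move=> D0; set S := \sum_(_ <= _ < _) _; set z := zeta _.
have z1 : 1 <= z by exact: zeta_ge1.
have z0 : 0 < z by apply: lt_le_trans z1.
have DR : 0 < D%:R :> R by rewrite ltr0n.
apply: (@le_trans _ _ `|S * z - 1|).
  have -> : S - z^-1 = (S * z - 1) / z by field; rewrite gt_eqF.
  rewrite normrM normfV ler_pdivrMr ?normr_gt0 ?gt_eqF //.
  by rewrite ler_peMr // ger0_norm // ltW.
rewrite -[X in `|_ - X|](sum_mobius_zeta R n.+2 D0) /S mulr_suml -sumrB.
apply: le_trans (ler_norm_sum _ _ _) _.
case: D D0 DR {S} => // D _ DR.
apply: (@le_trans _ _ (2 ^+ n.+1 / D.+1%:R ^+ n.+1 * \sum_(1 <= d < D.+2) d%:R^-1));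
  last first.
  rewrite [leLHS]mulrAC ler_pM2r ?invr_gt0 ?exprn_gt0 //.
  by rewrite ler_pM2l ?exprn_gt0 // harmonic_le_ln.
rewrite mulr_sumr; apply: ler_sum_nat => d /andP[d0 dD].
rewrite -mulrBr !normrM.
have dR : 0 < d%:R :> R by rewrite ltr0n.
have q0 : (0 < D.+1 %/ d)%N by rewrite divn_gt0.
have qR : 0 < (D.+1 %/ d)%:R :> R by rewrite ltr0n.
have /andP[h1 h2] := @zeta_bounds R n _ q0.
have mu1 : `|(mobius d)%:~R| <= 1 :> R.
  by rewrite -intr_norm -[1]/(1%:~R) ler_int mobius_norm.
have zt : `|z - zeta_sum R n.+2 (D.+1 %/ d)| <= ((D.+1 %/ d)%:R ^+ n.+1)^-1.
  by rewrite ger0_norm ?subr_ge0 // lerBlDl.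
have Dq : D.+1%:R <= 2 * d%:R * (D.+1 %/ d)%:R :> R.
  rewrite -!natrM ler_nat {1}(divn_eq D.+1 d) mulnC.
  have := ltn_pmod D.+1 d0; have : (d <= d * (D.+1 %/ d))%N by rewrite leq_pmulr.
  by rewrite -mulnA mul2n -addnn => a b; rewrite leq_add2l (leq_trans (ltnW b)).
have dinv : `|(d%:R ^+ n.+2)^-1| = (d%:R ^+ n.+2)^-1 :> R.
  by rewrite ger0_norm // invr_ge0 exprn_ge0.
rewrite dinv.
apply: (@le_trans _ _ (1 * (d%:R ^+ n.+2)^-1 * ((D.+1 %/ d)%:R ^+ n.+1)^-1)).
  by apply: ler_pM => //; rewrite ?mulr_ge0 ?ler_wpM2r ?invr_ge0 ?exprn_ge0.
have -> : (d%:R ^+ n.+2)^-1 = (d%:R ^+ n.+1)^-1 * d%:R^-1 :> R.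
  by rewrite -invfM -exprSr.
rewrite mul1r mulrAC.
rewrite ler_pM2r ?invr_gt0 //.
rewrite -invfM -exprMn ler_pdivlMr ?exprn_gt0 // mulrC ler_pdivrMr ?exprn_gt0 ?mulr_gt0 //.
rewrite -exprMn lerXn2r ?nnegrE ?mulr_ge0 //.
by rewrite mulrA.
Qed.

(** * Growth of [a^(t / log t)] and the number of squarefree divisors *)

Lemma ln_le_powR (R : realType) (t r : R) : 0 < r -> 1 <= t -> ln t <= t `^ r / r.
Proof.
move=> r0 t1; have t0 : 0 < t by apply: lt_le_trans t1.
rewrite ler_pdivlMr // mulrC -ln_powR.
have p0 : 0 < t `^ r by exact: powR_gt0.
have : ln (1 + (t `^ r - 1)) <= t `^ r - 1 by apply: le_ln1Dx; lra.
by rewrite addrC subrK; lra.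
Qed.

Lemma powR_ge_threshold (R : realType) (B r : R) : 0 < r ->
  exists2 T : R, 1 <= T & forall t, T <= t -> B <= t `^ r.
Proof.
move=> r0; pose B' := Num.max 1 B.
have B1 : 1 <= B' by rewrite /B' le_max lexx.
have T1 : 1 <= B' `^ r^-1 by rewrite -(powRr0 B') ler_powR // invr_ge0 ltW.
exists (B' `^ r^-1) => // t Bt.
apply: (@le_trans _ _ B'); first by rewrite /B' le_max lexx orbT.
have -> : B' = (B' `^ r^-1) `^ r.
  by rewrite -powRrM mulVf ?gt_eqF // powRr1 // (le_trans _ B1).
have T0 : 0 <= B' `^ r^-1 by rewrite (le_trans _ T1).
by apply: (ge0_ler_powR (ltW r0)) => //; rewrite nnegrE // (le_trans T0).
Qed.

Lemma expR_ln_powR (R : realType) (a x : R) : 0 < a -> a `^ x = expR (x * ln a).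
Proof. by move=> a0; rewrite /powR gt_eqF. Qed.

(** With [t = log delta] this absorbs the factor [1 + log u] of the error terms. It amounts to
    [ln (1 + t) * ln t <= t * ln a]. *)
Lemma log_le_powR_log (R : realType) (a : R) : 1 < a ->
  exists2 T : R, 1 <= T & forall t, T <= t -> 1 + t <= a `^ (t / ln t).
Proof.
move=> a1; have la : 0 < ln a by exact: ln_gt0.
have a0 : 0 < a by apply: lt_trans a1.
have r0 : 0 < 1 / 4 :> R by lra.
have r20 : 0 < 1 / 2 :> R by lra.
have [T T1 TB] := powR_ge_threshold (32 / ln a) r20.
exists (Num.max 2 T) => [|t]; first by rewrite le_max T1 orbT.
rewrite ge_max => /andP[t2 /TB]; rewrite ler_pdivrMr // => ht.
have t0 : 0 < t by lra.
have lt0 : 0 < ln t by rewrite ln_gt0 //; lra.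
rewrite expR_ln_powR // -ler_ln ?posrE ?expR_gt0 ?addr_gt0 // expRK.
rewrite mulrAC ler_pdivlMr //.
have h1 : ln (1 + t) <= ln t + ln t.
  rewrite -lnM ?posrE // ler_ln ?posrE ?mulr_gt0 ?addr_gt0 //; nra.
have t1 : 1 <= t by lra.
have h2 : ln t <= 4 * t `^ (1 / 4).
  by have := ln_le_powR r0 t1; rewrite ler_pdivlMr //; lra.
have e4 : t `^ (1 / 4) * t `^ (1 / 4) = t `^ (1 / 2).
  by rewrite -powRD; [congr (_ `^ _); field|rewrite gt_eqF // implybT].
have e2 : t `^ (1 / 2) * t `^ (1 / 2) = t.
  rewrite -powRD; last by rewrite gt_eqF // implybT.
  by rewrite -[RHS]powRr1 ?ltW //; congr (_ `^ _); field.
apply: (@le_trans _ _ (32 * t `^ (1 / 2))).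
  rewrite -e4; apply: (@le_trans _ _ ((ln t + ln t) * ln t)).
    by rewrite ler_pM2r.
  have := ler_pM (ltW lt0) (ltW lt0) h2 h2; lra.
rewrite -[t in leRHS]e2 [leRHS]mulrAC ler_pM2r ?powR_gt0 // mulrC; lra.
Qed.

(* With Y about t^th and 1 / th strictly between 1 and ln a / ln 2. *)
Lemma two_powR_threshold (R : realType) (a K : R) : 2 < a -> 0 <= K ->
  exists2 T : R, 1 <= T & forall t, T <= t -> exists2 Y : nat, (1 < Y)%N &
    2 `^ (Y%:R + (t + K) / ln Y%:R) <= a `^ (t / ln t).
Proof.
move=> a2 K0; have l2 : 0 < ln 2 :> R by rewrite ln_gt0 //; lra.
have a0 : 0 < a by lra.
pose L := ln a / ln 2.
have L1 : 1 < L by rewrite /L ltr_pdivlMr // mul1r ltr_ln ?posrE.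
pose th := 2 / (1 + L).
have th0 : 0 < th by rewrite divr_gt0 //; lra.
have th1 : th < 1 by rewrite /th ltr_pdivrMr; lra.
have thi : th^-1 = (1 + L) / 2 by rewrite /th invf_div.
(* The gap below 1 is halved, so that [t = t^th * t^r * t^r]: one factor [t^r] absorbs the
   logarithm, the other exceeds the constants. *)
pose r := (1 - th) / 2; have r0 : 0 < r by rewrite /r; lra.
have [T T1 TB] := powR_ge_threshold ((2 / r + K / th) / ((L - 1) / 2)) r0.
exists (Num.max (expR 1) T) => [|t]; first by rewrite le_max T1 orbT.
rewrite ge_max => /andP[te /TB]; rewrite ler_pdivrMr; last by lra.
move=> ht; have e1 : 1 < expR 1 :> R by rewrite expR_gt1.
have t1 : 1 <= t by lra.
have t0 : 0 < t by lra.
have lt1 : 1 <= ln t by rewrite -(expRK 1) ler_ln ?posrE ?expR_gt0.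
have tth1 : 1 <= t `^ th by rewrite -(powRr0 t) ler_powR // ltW.
pose Y := (Num.truncn (t `^ th)).+1.
have Y1 : t `^ th < Y%:R by exact: truncnS_gt.
have Y2 : Y%:R <= t `^ th + 1.
  by rewrite /Y -natr1 lerD2r; have /andP[] := truncn_itv (powR_ge0 t th).
have Yg1 : 1 < Y%:R :> R by lra.
exists Y; first by rewrite -(ltr_nat R).
have lY : th * ln t <= ln Y%:R.
  by rewrite -ln_powR ler_ln ?posrE ?powR_gt0 //; lra.
have lt0 : 0 < ln t by lra.
have lY0 : 0 < ln Y%:R :> R by rewrite ln_gt0.
rewrite !expR_ln_powR // ler_expR.
rewrite -ler_pdivlMr // -mulrA -/L.
have b1 : (t + K) / ln Y%:R <= (t + K) / (th * ln t).
  by rewrite ler_wpM2l ?lef_pV2 ?posrE ?(mulr_gt0 th0 lt0) ?addr_ge0 ?(ltW t0).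
apply: (@le_trans _ _ ((t `^ th + 1) + (t + K) / (th * ln t))); first lra.
rewrite -(ler_pM2r lt0) mulrDl.
have -> : (t + K) / (th * ln t) * ln t = (t + K) * th^-1.
  by field; rewrite !gt_eqF.
have -> : t / ln t * L * ln t = t * L by field; rewrite gt_eqF.
have h2 : ln t <= t `^ r / r by exact: ln_le_powR.
have r1 : 1 <= t `^ r by rewrite -(powRr0 t) ler_powR // ltW.
have tr : t `^ th * t `^ r * t `^ r = t.
  rewrite -!powRD ?(gt_eqF t0) ?implybT //.
  rewrite -[RHS]powRr1 ?ltW //; congr (_ `^ _); rewrite /r; lra.
have b2 : (t `^ th + 1) * ln t + K * th^-1 <= (2 / r + K / th) * (t `^ th * t `^ r).
  rewrite [leRHS]mulrDl; apply: lerD.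
    apply: (@le_trans _ _ ((2 * t `^ th) * (t `^ r / r))).
      by apply: ler_pM => //; lra.
    by rewrite le_eqVlt; apply/orP; left; apply/eqP; ring.
  apply: ler_peMr; first by rewrite mulr_ge0 // invr_ge0 ltW.
  exact: mulr_ege1.
have := ler_wpM2r (mulr_ge0 (le_trans ler01 tth1) (le_trans ler01 r1)) ht.
rewrite -[t `^ r * _ * _](_ : (L - 1) / 2 * t = _); last first.
  by rewrite -{1}tr; ring.
move: b2; rewrite mulrDl thi; lra.
Qed.

(** Meant for [t = log delta]. From [m <= K * delta] follows [log m <= t + log K], and the shift by
    [log K] is lost in the room between 2 and [a]. *)
Lemma sqfree_divisors_bound (R : realType) (a K : R) : 2 < a ->
  exists T : R, forall (t : R) (m : nat), T <= t -> (0 < m)%N -> m%:R <= K * expR t ->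
    (size [seq d <- divisors m | mobius d != 0])%:R <= a `^ (t / ln t).
Proof.
move=> a2; pose K' := Num.max 1 K.
have K1 : 1 <= K' by rewrite /K' le_max lexx.
have [T T1 TY] := two_powR_threshold a2 (ln_ge0 K1).
exists T => t m /TY[Y Y1 hY] m0 mK; apply: le_trans hY.
have := card_sqfree_divisors m0; rewrite -(ler_nat R) => h; apply: (le_trans h).
rewrite natrX -powR_mulrn // ler_powR //; first by rewrite ler1n.
apply: le_trans (num_primes_le R m0 Y1) _; rewrite lerD2l.
have lY : 0 < ln Y%:R :> R by rewrite ln_gt0 // ltr1n.
rewrite ler_pM2r ?invr_gt0 //.
have mR : 0 < m%:R :> R by rewrite ltr0n.
have KR : 0 < K' by apply: lt_le_trans K1.
rewrite -[t]expRK addrC -lnM ?posrE ?expR_gt0 //.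
rewrite ler_ln ?posrE ?mulr_gt0 ?expR_gt0 //.
apply: le_trans mK _; rewrite ler_pM2r ?expR_gt0 //.
by rewrite /K' le_max lexx orbT.
Qed.

Lemma card_fset_set_inj (T : finType) (X : choiceType) (f : T -> X) (S : set X)
    (P : pred T) : injective f -> (forall x, S x -> exists t, f t = x) ->
  (forall t, P t <-> S (f t)) -> #|` fset_set S| = (\sum_t P t)%N.
Proof.
move=> finj fsurj PS.
have SE : S = [set` [fset f t | t in P]%fset].
  apply/seteqP; split => [x Sx|x /= /imfsetP[t Pt ->]]; last exact/PS.
  by have [t tx] := fsurj _ Sx; apply/imfsetP; exists t => //=; apply/PS; rewrite tx.
rewrite SE set_fsetK card_imfset //= -cardE -sum1_card big_mkcond /=.
by apply: eq_bigr => t _; rewrite unfold_in; case: (P t).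
Qed.

(** * Lattice points in a cube *)

(** As [V] is unimodular, [V x] runs over all integral vectors, and [V x / m] over the grid of step
    [1/m]. The bound [B] only serves to choose [c] so large that the finite grid covers [K]. *)
Lemma grid_count (R : realType) (n c m : nat) (U V : 'M[int]_n) (K : pred 'cV[R]_n)
    (B : R) : U *m V = 1%:M -> V *m U = 1%:M -> (0 < m)%N -> m%:R * B <= c%:R ->
  (forall w, K w -> forall i, `|w i 0| <= B) ->
  #|` fset_set [set x : 'cV[int]_n | K (m%:R^-1 *: real_vec R (V *m x))]|%:R =
  m%:R ^+ n * box_mass c (fun=> m) K.
Proof.
move=> UV VU m0 mBc KB.
have mR : 0 < m%:R :> R by rewrite ltr0n.
pose z (f : {ffun 'I_n -> 'I_c.*2.+1}) : 'cV[int]_n := \col_i ((f i)%:Z - c%:Z).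
have zE f : m%:R^-1 *: real_vec R (z f) = grid R (fun=> m) f.
  apply/colP => i; rewrite !mxE /grid_point mulrC; congr (_ * _).
  by rewrite intrB.
rewrite (@card_fset_set_inj _ _ (fun f => U *m z f) _ (fun f => K (grid R (fun=> m) f))).
- rewrite /box_mass mulrA prodr_const card_ord -exprMn mulfV ?gt_eqF // expr1n mul1r.
  by rewrite natr_sum.
- move=> f g /(congr1 (mulmx V)); rewrite !mulmxA VU !mul1mx => /colP fg.
  apply/ffunP => i; have := fg i; rewrite !mxE => /addIr [] h.
  exact: val_inj.
- move=> x /= Kx; set y := V *m x in Kx.
  have yc i : - c%:Z <= y i 0 <= c%:Z.
    rewrite -ler_norml -(ler_int R) intr_norm; apply: le_trans mBc.
    have := KB _ Kx i; rewrite !mxE normrM gtr0_norm ?invr_gt0 //.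
    by rewrite ler_pdivrMl.
  exists [ffun i => inord (absz (y i 0 + c%:Z))].
  rewrite -[RHS]mul1mx -UV -mulmxA -/y; congr (_ *m _).
  apply/colP => i; rewrite [LHS]mxE ffunE; have /andP[y1 y2] := yc i.
  have y0 : 0 <= y i 0 + c%:Z by lia.
  rewrite inordK; last by rewrite -ltz_nat gez0_abs // -addnn; lia.
  by rewrite gez0_abs // addrK.
- by move=> f /=; rewrite mulmxA VU mul1mx zE.
Qed.

Definition cube_pred (R : realType) (k n : nat) (A : 'M[R]_(k, n)) (b : 'cV[R]_k) :
  pred 'cV[R]_n := fun w => [forall i, 0 <= (A *m w - b) i 0 <= 1].

Lemma cube_pred_convex (R : realType) (k n : nat) (A : 'M[R]_(k, n)) (b : 'cV[R]_k) :
  coord_convex (cube_pred A b).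
Proof.
move=> v j t1 t2 t /forallP h1 /forallP h2 /andP[t1t tt2]; apply/forallP => i.
have E s : (A *m set_coord v j s - b) i 0 =
    (A *m set_coord v j 0 - b) i 0 + s * A i j.
  rewrite !mxE addrAC; congr (_ - _).
  rewrite (bigD1 j) //= [in RHS](bigD1 j) //= !mxE eqxx mulr0 add0r mulrC addrC.
  by congr (_ + _); apply: eq_bigr => l /negbTE lj; rewrite !mxE lj.
have := h1 i; have := h2 i; rewrite (E t) (E t1) (E t2).
have [A0|A0] := leP 0 (A i j).
  have := ler_wpM2r A0 t1t; have := ler_wpM2r A0 tt2.
  by move=> ? ? /andP[? ?] /andP[? ?]; apply/andP; split; lra.
have := ler_wnM2r (ltW A0) t1t; have := ler_wnM2r (ltW A0) tt2.
by move=> ? ? /andP[? ?] /andP[? ?]; apply/andP; split; lra.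
Qed.

Lemma euclidean_norm_le (R : realType) (n : nat) (v : 'cV[R]_n) (T : R) :
  0 <= T -> (forall i, `|v i 0| <= T) -> euclidean_norm v <= n%:R * T.
Proof.
move=> T0 vT; rewrite /euclidean_norm -[leRHS]ger0_norm ?mulr_ge0 // -sqrtr_sqr.
rewrite ler_sqrt ?sqr_ge0 //.
apply: (@le_trans _ _ (\sum_(i < n) T ^+ 2)).
  apply: ler_sum => i _; rewrite -[leLHS]real_normK ?num_real //.
  by rewrite lerXn2r ?nnegrE.
rewrite sumr_const card_ord -[leLHS]mulr_natl exprMn ler_wpM2r ?sqr_ge0 //.
by rewrite -natrX ler_nat; case: n {v vT} => // n; rewrite leq_pmulr.
Qed.

Definition cube_count (R : realType) (k n : nat) (A : 'M[R]_(k, n)) (b : 'cV[R]_k)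
    (t : R) : nat :=
  #|` fset_set [set x : 'cV[int]_n | cube_pred A b (t *: real_vec R x)]|.

Section ReducedCount.
Variables (R : realType) (k n : nat) (A : 'M[R]_(k, n)) (b : 'cV[R]_k).
Variables (U V : 'M[int]_n) (M : R).
Hypothesis UV : U *m V = 1%:M.
Hypothesis VU : V *m U = 1%:M.
Hypothesis M0 : 0 <= M.
Hypothesis VA : forall (x : 'cV[R]_n) i,
  `|(map_mx intr V *m x) i 0| <= M * euclidean_norm (A *m x).

(** The cube shrunk by [d], in the coordinates [z = V x]. *)
Let K (d : R) : pred 'cV[R]_n := cube_pred (d *: (A *m map_mx intr U)) b.

Let K_width d w w' i : 0 < d -> K d w -> K d w' ->
  `|w i 0 - w' i 0| <= k%:R * M / d.
Proof.
move=> d0 /forallP Kw /forallP Kw'.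
have -> : w i 0 - w' i 0 = (map_mx intr V *m (map_mx intr U *m (w - w'))) i 0.
  by rewrite mulmxA -map_mxM VU map_mx1 mul1mx !mxE.
apply: le_trans (VA _ i) _.
rewrite [k%:R * M]mulrC -mulrA ler_wpM2l //.
apply: euclidean_norm_le => [|j]; first by rewrite invr_ge0 ltW.
have := Kw j; have := Kw' j; rewrite !mulmxA mulmxBr.
set P := A *m map_mx intr U.
have E x : (d *: P *m x - b) j 0 = d * (P *m x) j 0 - b j 0.
  by rewrite -scalemxAl mxE [(- b) j 0]mxE [(d *: (P *m x)) j 0]mxE.
rewrite !E => /andP[h1 h2] /andP[h3 h4].
rewrite mxE [(- (P *m w')) j 0]mxE.
rewrite -[d^-1]mul1r ler_pdivlMr // -{1}(gtr0_norm d0) -normrM mulrC mulrBr.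
by rewrite ler_norml; apply/andP; split; lra.
Qed.

(** The box is centred at an arbitrary point of [K d], hence its side is twice the width. Only this
    side enters the estimates; [B] depends on the position and merely fixes the size of the grid. *)
Let K_box d : 0 < d -> exists (x : 'I_n -> R) (B : R),
  (forall w, K d w -> forall i, x i <= w i 0 <= x i + 2 * (k%:R * M / d)) /\
  (forall w, K d w -> forall i, `|w i 0| <= B).
Proof.
move=> d0; have [[w0 Kw0]|K0] := pselect (exists w, K d w); last first.
  by exists (fun=> 0), 0; split=> w Kw; case: K0; exists w.
exists (fun i => w0 i 0 - k%:R * M / d), (\sum_i `|w0 i 0| + k%:R * M / d).
split=> w Kw i; have := K_width i d0 Kw Kw0.
  by rewrite ler_norml => /andP[h1 h2]; apply/andP; split; lra.
move=> h; have : `|w i 0| <= `|w i 0 - w0 i 0| + `|w0 i 0|.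
  by rewrite -{1}[w i 0](subrK (w0 i 0)) ler_normD.
have : `|w0 i 0| <= \sum_i `|w0 i 0| by rewrite (bigD1 i) //= lerDl sumr_ge0.
lra.
Qed.

Let L0 d : 0 < d -> 0 <= 2 * (k%:R * M / d).
Proof. by move=> d0; rewrite !mulr_ge0 // invr_ge0 ltW. Qed.

Let large_nat (x y : R) : exists c : nat, x <= c%:R /\ y <= c%:R.
Proof.
exists (Num.truncn (Num.max x y)).+1; have := truncnS_gt (Num.max x y).
by rewrite gt_max => /andP[/ltW ? /ltW ?].
Qed.

Let count_mass d m c B : 0 < d -> (0 < m)%N -> m%:R * B <= c%:R ->
  (forall w, K d w -> forall i, `|w i 0| <= B) ->
  (cube_count A b (d / m%:R))%:R = m%:R ^+ n * box_mass c (fun=> m) (K d).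
Proof.
move=> d0 m0 mB KB; rewrite -(grid_count UV VU m0 mB KB); congr (_%:R).
rewrite /cube_count; congr (#|` fset_set _|); apply/seteqP.
have E (x : 'cV[int]_n) : d *: (A *m map_mx intr U) *m (m%:R^-1 *: real_vec R (V *m x)) =
    A *m ((d / m%:R) *: real_vec R x).
  rewrite /real_vec map_mxM -!scalemxAr -!scalemxAl scalerA mulrC; congr (_ *: _).
  by rewrite mulmxA -[A *m _ *m _]mulmxA -map_mxM UV map_mx1 mulmx1.
by split=> x /= /forallP h; apply/forallP => i; have := h i; rewrite E.
Qed.

(* t x in the cube with t = d / m says that x / m is in the cube shrunk by d. *)
Lemma cube_count_refine d m : 0 < d -> (0 < m)%N ->
  `|(cube_count A b d)%:R - (m%:R ^+ n)^-1 * (cube_count A b (d / m%:R))%:R|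
    <= n%:R * (2 * (2 * (k%:R * M / d) + 1) ^+ n.-1).
Proof.
move=> d0 m0; have [x [B [Kx KB]]] := K_box d0.
have [c [cB cmB]] := large_nat B (m%:R * B).
have mR : m%:R != 0 :> R by rewrite pnatr_eq0 -lt0n.
rewrite -{1}[d]divr1 (count_mass (m := 1%N) (c := c) d0 _ _ KB) ?mul1r //.
rewrite expr1n mul1r (count_mass d0 m0 cmB KB) mulKf ?expf_neq0 //.
by apply: (box_mass_compare m0 (L0 d0) cB cmB) Kx => //; exact: cube_pred_convex.
Qed.

Lemma cube_count_le d : 0 < d ->
  (cube_count A b d)%:R <= (2 * (k%:R * M / d) + 1) ^+ n.
Proof.
move=> d0; have [x [B [Kx KB]]] := K_box d0.
have [c [cB _]] := large_nat B B.
rewrite -{1}[d]divr1 (count_mass (m := 1%N) (c := c) d0 _ _ KB) ?mul1r //.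
by rewrite expr1n mul1r; apply: (@box_mass_le _ _ _ _ _ x) => //; exact: L0.
Qed.

Lemma cube_finite d : 0 < d ->
  finite_set [set x : 'cV[int]_n | cube_pred A b (d *: real_vec R x)].
Proof.
move=> d0; have [x [B [Kx KB]]] := K_box d0.
have [c [cB _]] := large_nat B B.
apply: (@sub_finite_set _ _ (mulmx U @` [set v : 'cV[int]_n | forall i, (absz (v i 0%R) <= c)%N])).
  move=> v /= cv; exists (V *m v); last by rewrite mulmxA UV mul1mx.
  move=> i /=; rewrite -(ler_nat R) natr_absz intr_norm.
  have Kv : K d (real_vec R (V *m v)).
    have E : d *: (A *m map_mx intr U) *m real_vec R (V *m v) = A *m (d *: real_vec R v).
      rewrite /real_vec map_mxM -scalemxAr -scalemxAl; congr (_ *: _).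
      by rewrite mulmxA -[A *m _ *m _]mulmxA -map_mxM UV map_mx1 mulmx1.
    by apply/forallP => j; have /forallP/(_ j) := cv; rewrite E.
  by have := KB _ Kv i; rewrite mxE => h; apply: le_trans cB.
exact/finite_image/finite_bounded_intvec.
Qed.

End ReducedCount.

(** * Common divisors of the coordinates and Moebius inversion *)

Lemma dvd_biggcd (I : finType) (F : I -> nat) (d : nat) :
  (d %| \big[gcdn/0%N]_i F i)%N = [forall i, (d %| F i)%N].
Proof.
apply/idP/forallP => [h i|h].
  by apply: dvdn_trans h _; rewrite (bigD1 i) //= dvdn_gcdl.
by elim/big_ind: _ => // x y dx dy; rewrite dvdn_gcd dx.
Qed.

Definition coord_gcd (n : nat) (v : 'cV[int]_n) : nat :=
  \big[gcdn/0%N]_(i < n) `|v i 0%R|%N.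

Lemma dvd_coord_gcd (n : nat) (v : 'cV[int]_n) (d : nat) :
  (d %| coord_gcd v)%N = [forall i, (d %| `|v i 0%R|)%N].
Proof. exact: dvd_biggcd. Qed.

Lemma coord_gcd_eq0 (n : nat) (v : 'cV[int]_n) : (coord_gcd v == 0%N) = (v == 0).
Proof.
rewrite -dvd0n dvd_coord_gcd; apply/forallP/eqP => [h|-> i]; last by rewrite mxE.
by apply/colP => i; have := h i; rewrite dvd0n absz_eq0 mxE => /eqP.
Qed.

Lemma coord_gcd_scale (n : nat) (v : 'cV[int]_n) (d : nat) :
  (d %| coord_gcd (d%:Z *: v))%N.
Proof. by rewrite dvd_coord_gcd; apply/forallP => i; rewrite mxE abszM dvdn_mulr. Qed.

Lemma coord_gcd_divide (n : nat) (v : 'cV[int]_n) (d : nat) : (d %| coord_gcd v)%N ->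
  exists w : 'cV[int]_n, v = d%:Z *: w.
Proof.
rewrite dvd_coord_gcd => /forallP h; exists (\col_i (v i 0%R %/ d%:Z)%Z).
by apply/colP => i; rewrite !mxE mulrC divzK // dvdzE.
Qed.

Lemma coord_gcd_mulmx (m n : nat) (V : 'M[int]_(m, n)) (v : 'cV[int]_n) (d : nat) i :
  (d %| coord_gcd v)%N -> (d %| `|(V *m v) i 0%R|)%N.
Proof.
by move=> /coord_gcd_divide[w ->]; rewrite -scalemxAr mxE abszM dvdn_mulr.
Qed.

(** Elements with [g x = 0] are left out on the right, since every [d] divides 0 and they would
    contribute the sum of all Moebius values up to [D]. *)
Lemma primitive_count (X : choiceType) (F : {fset X}) (g : X -> nat) (D : nat) :
  (forall x, x \in F -> (g x <= D)%N) ->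
  (\sum_(x <- F) (g x == 1%N))%N%:R =
    \sum_(1 <= d < D.+1) mobius d * (\sum_(x <- F | g x != 0%N) (d %| g x))%N%:R.
Proof.
move=> gD; rewrite natr_sum.
transitivity (\sum_(x <- F | g x != 0%N) \sum_(1 <= d < D.+1 | (d %| g x)%N) mobius d).
  rewrite [RHS]big_mkcond big_seq [RHS]big_seq; apply: eq_bigr => x xF.
  have [->|g0] := eqVneq (g x) 0%N; first by [].
  by rewrite sum_mobius_dvd ?lt0n // ltnS gD.
under eq_bigr => x _ do rewrite big_mkcond.
rewrite exchange_big /=; apply: eq_bigr => d _.
rewrite natr_sum mulr_sumr; apply: eq_bigr => x _.
by case: (d %| g x)%N; rewrite ?mulr1 ?mulr0.
Qed.

(** * The main term as a limit of grid masses *)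

Definition ffun_join (r s : nat) (T : Type) (g : {ffun 'I_r -> T}) (h : {ffun 'I_s -> T}) :
    {ffun 'I_(r + s) -> T} :=
  [ffun i => match fintype.split i with inl j => g j | inr j => h j end].

Lemma ffun_joinl (r s : nat) (T : Type) (g : {ffun 'I_r -> T}) (h : {ffun 'I_s -> T}) i :
  ffun_join g h (lshift s i) = g i.
Proof. by rewrite ffunE; case: split_ordP => j => [/lshift_inj->|/eqP]; rewrite ?eq_lrshift. Qed.

Lemma ffun_joinr (r s : nat) (T : Type) (g : {ffun 'I_r -> T}) (h : {ffun 'I_s -> T}) i :
  ffun_join g h (rshift r i) = h i.
Proof. by rewrite ffunE; case: split_ordP => j => [/eqP|/rshift_inj->]; rewrite ?eq_rlshift. Qed.

Lemma sum_ffun_join (V : nmodType) (r s : nat) (T : finType)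
    (F : {ffun 'I_(r + s) -> T} -> V) :
  \sum_f F f = \sum_(h : {ffun 'I_s -> T}) \sum_(g : {ffun 'I_r -> T}) F (ffun_join g h).
Proof.
rewrite pair_big /= (reindex (fun x : {ffun 'I_s -> T} * {ffun 'I_r -> T} =>
  ffun_join x.2 x.1)) //=.
exists (fun f => ([ffun j => f (rshift r j)], [ffun i => f (lshift s i)])) => [[h g]|f] _ /=.
  by congr pair; apply/ffunP => i; rewrite ffunE ?ffun_joinl ?ffun_joinr.
apply/ffunP => i; case: (split_ordP i) => j ->.
  by rewrite ffun_joinl ffunE.
by rewrite ffun_joinr ffunE.
Qed.

(** Fubini on the grid: over each grid point [q] in [J'] the fibre is a product of sets that may
    depend on [q]. *)
Lemma box_mass_fibration (R : realType) (r s c m : nat) (K : pred 'cV[R]_(r + s))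
    (J : 'I_r -> 'cV[R]_s -> pred R) (J' : pred 'cV[R]_s) :
  (forall p q, K (col_mx p q) = [forall i, J i q (p i 0)] && J' q) ->
  box_mass c (fun=> m) K = m%:R^-1 ^+ s * \sum_(h : {ffun 'I_s -> 'I_c.*2.+1})
    (J' (grid R (fun=> m) h))%:R * \prod_i grid_mass c m (J i (grid R (fun=> m) h)).
Proof.
move=> KE; rewrite {1}/box_mass sum_ffun_join prodr_const card_ord exprD mulrAC mulrC.
congr (_ * _); rewrite mulr_sumr; apply: eq_bigr => h _.
set q := grid R _ h.
have gE (g : {ffun 'I_r -> 'I_c.*2.+1}) :
    grid R (fun=> m) (ffun_join g h) = col_mx (grid R (fun=> m) g) q.
  apply/colP => i; case: (split_ordP i) => j ->.
    by rewrite col_mxEu !mxE ffun_joinl.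
  by rewrite col_mxEd !mxE ffun_joinr.
have := @box_mass_prod R r c (fun=> m) (fun i => J i q)
  (fun v => [forall i, J i q (v i 0)]) (fun=> erefl).
rewrite /box_mass prodr_const card_ord => <-.
rewrite mulrCA; congr (_ * _); rewrite mulr_sumr; apply: eq_bigr => g _.
by rewrite gE KE -mulnb natrM mulrC.
Qed.

Lemma prod_between (R : realType) (n : nat) (F : 'I_n -> R) (lo hi : R) : 0 <= lo ->
  (forall i, lo <= F i <= hi) -> lo ^+ n <= \prod_i F i <= hi ^+ n.
Proof.
move=> lo0 HF; have e x : x ^+ n = \prod_(i < n) x by rewrite prodr_const card_ord.
rewrite [lo ^+ n]e [hi ^+ n]e.
apply/andP; split; apply: ler_prod => j _; have /andP[h1 h2] := HF j.
  by rewrite lo0.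
by rewrite h2 (le_trans lo0).
Qed.

Lemma box_mass_fibration_bounds (R : realType) (r s c m : nat) (K : pred 'cV[R]_(r + s))
    (J : 'I_r -> 'cV[R]_s -> pred R) (J' : 'I_s -> pred R) (lo hi lo' hi' : R) :
  (forall p q, K (col_mx p q) =
    [forall i, J i q (p i 0)] && [forall j, J' j (q j 0)]) ->
  0 <= lo <= hi -> 0 <= lo' ->
  (forall i (q : 'cV[R]_s), (forall j, J' j (q j 0)) -> lo <= grid_mass c m (J i q) <= hi) ->
  (forall j, lo' <= grid_mass c m (J' j) <= hi') ->
  lo ^+ r * lo' ^+ s <= box_mass c (fun=> m) K <= hi ^+ r * hi' ^+ s.
Proof.
move=> KE /andP[lo0 lohi] lo'0 HJ HJ'; have hi0 := le_trans lo0 lohi.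
rewrite (box_mass_fibration _ _ (J := J) (J' := fun q => [forall j, J' j (q j 0)])) //.
have e := @box_mass_prod R s c (fun=> m) J' (fun v => [forall j, J' j (v j 0)]) (fun=> erefl).
rewrite /box_mass prodr_const card_ord in e.
have /andP[b'1 b'2] := prod_between lo'0 HJ'.
have mi0 : 0 <= m%:R^-1 ^+ s :> R by rewrite exprn_ge0 // invr_ge0.
have b (h : {ffun 'I_s -> 'I_c.*2.+1}) :
    let q : 'cV[R]_s := grid R (fun=> m) h in
    [forall j, J' j (q j 0)] ->
    lo ^+ r <= \prod_i grid_mass c m (J i q) <= hi ^+ r.
  by move=> q /forallP Jq; apply: prod_between => // i; exact: HJ.
apply/andP; split.
  apply: (@le_trans _ _ (lo ^+ r * \prod_j grid_mass c m (J' j))).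
    by rewrite ler_wpM2l ?exprn_ge0.
  rewrite -e mulrCA ler_wpM2l // mulr_sumr; apply: ler_sum => h _.
  have [/(b h)/andP[]|_] /= := boolP [forall j, J' j (grid R (fun=> m) h j 0)].
    by rewrite mulr1 mul1r.
  by rewrite mulr0 mul0r.
apply: (@le_trans _ _ (hi ^+ r * \prod_j grid_mass c m (J' j))); last first.
  by rewrite ler_wpM2l ?exprn_ge0.
rewrite -e [leRHS]mulrCA ler_wpM2l // mulr_sumr; apply: ler_sum => h _.
have [/(b h)/andP[]|_] /= := boolP [forall j, J' j (grid R (fun=> m) h j 0)].
  by rewrite mulr1 mul1r.
by rewrite mulr0 mul0r.
Qed.

Definition box_mx (R : realType) (r s : nat) (Theta : 'M[R]_(r, s)) (eps Q : R) :
    'M[R]_(r + s) :=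
  block_mx (eps^-1)%:M (eps^-1 *: Theta) 0 (Q^-1)%:M.

Definition box_vec (R : realType) (r s : nat) (y : 'cV[R]_r) (eps : R) : 'cV[R]_(r + s) :=
  col_mx (eps^-1 *: y) (0 : 'cV[R]_s).

Lemma box_mxE (R : realType) (r s : nat) (Theta : 'M[R]_(r, s)) (eps Q : R)
    (p : 'cV[R]_r) (q : 'cV[R]_s) :
  box_mx Theta eps Q *m col_mx p q = col_mx (eps^-1 *: (p + Theta *m q)) (Q^-1 *: q).
Proof.
by rewrite mul_block_col !mul_scalar_mx -scalemxAl mul0mx add0r scalerDr.
Qed.

Lemma box_predE (R : realType) (r s : nat) (Theta : 'M[R]_(r, s)) (y : 'cV[R]_r)
    (eps Q : R) (p : 'cV[R]_r) (q : 'cV[R]_s) : 0 < eps -> 0 < Q ->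
  cube_pred (box_mx Theta eps Q) (box_vec s y eps) (col_mx p q) =
  [forall i, 0 <= (p + Theta *m q - y) i 0 <= eps] && [forall j, 0 <= q j 0 <= Q].
Proof.
move=> e0 Q0; rewrite /cube_pred box_mxE /box_vec opp_col_mx add_col_mx -scalerBr subr0.
have H (t a : R) : 0 < a -> (0 <= a^-1 * t <= 1) = (0 <= t <= a).
  by move=> a0; rewrite mulrC pmulr_lge0 ?invr_gt0 // ler_pdivrMr // mul1r.
apply/idP/idP => [/forallP h|/andP[/forallP h1 /forallP h2]].
  apply/andP; split; apply/forallP => i.
    by have := h (lshift s i); rewrite col_mxEu mxE H.
  by have := h (rshift r i); rewrite col_mxEd mxE H.
apply/forallP => i; case: (split_ordP i) => j ->.
  by rewrite col_mxEu mxE H.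
by rewrite col_mxEd mxE H.
Qed.

(** Shrunk by [d], the region is a sheared box: over each [q] in a cube of side [Q / d] the fibre is
    a cube of side [eps / d], and only its position depends on [q]. Every interval has mass within
    [1/m] of its length, so the total lies between [g (- 1/m)] and [g (1/m)], and [g] is continuous
    at 0. *)
Lemma box_count_volume (R : realType) (r s : nat) (Theta : 'M[R]_(r, s)) (y : 'cV[R]_r)
    (eps Q d e : R) : 0 < eps -> 0 < Q -> 0 < d -> 0 < e ->
  exists2 m : nat, (0 < m)%N &
    `|(m%:R ^+ (r + s))^-1 *
       (cube_count (box_mx Theta eps Q) (box_vec s y eps) (d / m%:R))%:R -
      eps ^+ r * Q ^+ s / d ^+ (r + s)| <= e.
Proof.
move=> eps0 Q0 d0 e0.
pose l := eps / d; pose l' := Q / d.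
have l0 : 0 < l by exact: divr_gt0.
have l'0 : 0 < l' by exact: divr_gt0.
pose g (t : R) := (l + t) ^+ r * (l' + t) ^+ s.
have gc : g t @[t --> (0 : R)] --> g 0.
  have H (a : R) (n : nat) : (a + t) ^+ n @[t --> (0 : R)] --> (a + 0) ^+ n.
    apply: (@continuous_comp _ _ _ (fun t => a + t) (fun x => x ^+ n)).
      by apply: cvgD; [exact: cvg_cst|exact: cvg_id].
    exact: exprn_continuous.
  by apply: cvgM; exact: H.
have [eta eta0 geta] : exists2 eta : R, 0 < eta & forall t, `|t| < eta -> `|g t - g 0| <= e.
  have /cvgrPdist_le /(_ e e0) := gc; rewrite -nbhs_nearE => /nbhs_ballP[eta eta0 h].
  exists eta => // t tb; rewrite distrC; apply: h.
  by rewrite /ball /= sub0r normrN.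
have g0 : g 0 = eps ^+ r * Q ^+ s / d ^+ (r + s).
  by rewrite /g !addr0 /l /l' !expr_div_n exprD; field; rewrite !expf_neq0 ?gt_eqF.
rewrite -g0.
(* Apart from [1/m < eta], the sides [l] and [l'] must exceed [1/m] for the lower bounds to be
   nonnegative and hence multiply. *)
pose m := (Num.truncn (eta^-1 + l^-1 + l'^-1)).+1.
have mR : 0 < m%:R :> R by rewrite ltr0n.
have mbig : eta^-1 + l^-1 + l'^-1 < m%:R by exact: truncnS_gt.
have minv x : 0 < x -> x^-1 <= eta^-1 + l^-1 + l'^-1 -> m%:R^-1 < x.
  move=> x0 hx; rewrite -[x]invrK ltf_pV2 ?posrE ?invr_gt0 //.
  exact: le_lt_trans mbig.
have ei : 0 < eta^-1 by rewrite invr_gt0.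
have li : 0 < l^-1 by rewrite invr_gt0.
have l'i : 0 < l'^-1 by rewrite invr_gt0.
have m_eta : m%:R^-1 < eta by apply: minv => //; lra.
have m_l : m%:R^-1 < l by apply: minv => //; lra.
have m_l' : m%:R^-1 < l' by apply: minv => //; lra.
have mi0 : 0 < m%:R^-1 :> R by rewrite invr_gt0.
exists m => //.
pose B := (\sum_i `|y i 0| + \sum_i \sum_j `|Theta i j| * Q + eps + Q) / d.
pose c := (Num.truncn (m%:R * B)).+1.
have mBc : m%:R * B <= c%:R by apply/ltW; exact: truncnS_gt.
pose x i (q : 'cV[R]_s) := y i 0 / d - (Theta *m q) i 0.
pose J i (q : 'cV[R]_s) : pred R := [pred t | x i q <= t <= x i q + l].
pose J' (j : 'I_s) : pred R := [pred t | 0 <= t <= l'].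
pose K : pred 'cV[R]_(r + s) := fun w =>
  cube_pred (box_mx Theta eps Q) (box_vec s y eps) (d *: w).
have Thq i (q : 'cV[R]_s) : (forall j, J' j (q j 0)) ->
    `|(Theta *m q) i 0| <= \sum_j `|Theta i j| * l'.
  move=> Jq; rewrite mxE; apply: le_trans (ler_norm_sum _ _ _) _.
  apply: ler_sum => j _; rewrite normrM ler_wpM2l //.
  by have /andP[q0 ql] := Jq j; rewrite ger0_norm.
have xB i (q : 'cV[R]_s) : (forall j, J' j (q j 0)) -> - B <= x i q /\ x i q + l <= B.
  move=> /(Thq i); rewrite ler_norml => /andP[t1 t2].
  have y1 : `|y i 0| <= \sum_i `|y i 0| by rewrite (bigD1 i) //= lerDl sumr_ge0.
  have T1 : \sum_j `|Theta i j| * l' <= (\sum_i \sum_j `|Theta i j| * Q) / d.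
    rewrite [leRHS]mulr_suml (bigD1 i) //= mulr_suml -[leLHS]addr0; apply: lerD.
      by rewrite le_eqVlt; apply/orP; left; apply/eqP; apply: eq_bigr => j _; rewrite /l' mulrA.
    apply: sumr_ge0 => i' _; rewrite mulr_ge0 ?invr_ge0 ?(ltW d0) //.
    by apply: sumr_ge0 => j _; rewrite mulr_ge0 ?(ltW Q0).
  have yd : `|y i 0 / d| <= (\sum_i `|y i 0|) / d.
    by rewrite normrM [X in _ * X]gtr0_norm ?invr_gt0 // ler_pM2r ?invr_gt0.
  have BE : B = (\sum_i `|y i 0|) / d + (\sum_i \sum_j `|Theta i j| * Q) / d + l + l'.
    by rewrite /B !mulrDl.
  move: yd; rewrite ler_norml => /andP[yd1 yd2].
  by rewrite /x BE; split; lra.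
have l'B : l' <= B.
  rewrite /l' /B ler_pM2r ?invr_gt0 // lerDr !addr_ge0 ?sumr_ge0 ?(ltW eps0) // => i _.
  by apply: sumr_ge0 => j _; rewrite mulr_ge0 ?(ltW Q0).
have KE p q : K (col_mx p q) = [forall i, J i q (p i 0)] && [forall j, J' j (q j 0)].
  rewrite /K scale_col_mx box_predE //; congr (_ && _); apply: eq_forallb => i.
    rewrite -scalemxAr -scalerDr /J /x /= mxE [(d *: (p + Theta *m q)) i 0]mxE.
    rewrite [(- y) i 0]mxE [(p + _) i 0]mxE; set z := (Theta *m q) i 0.
    have -> : d * (p i 0 + z) - y i 0 = d * (p i 0 - (y i 0 / d - z)).
      by field; rewrite gt_eqF.
    rewrite pmulr_rge0 // subr_ge0 [d * _]mulrC -ler_pdivlMr //.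
    by rewrite [p i 0 - _ <= _]lerBlDr [eps / d + _]addrC.
  by rewrite /J' /l' /= mxE pmulr_rge0 // ler_pdivlMr // mulrC.

have c0 : (0 : R) <= c%:R by [].
have J'mass j : l' - m%:R^-1 <= grid_mass c m (J' j) <= l' + m%:R^-1.
  have h1 : m%:R * l' <= c%:R by apply: le_trans mBc; rewrite ler_pM2l.
  apply/andP; split.
    rewrite -[l']subr0; apply: grid_mass_ge => //; first by rewrite mulr0 oppr_le0.
    by move=> t /andP[t1 t2]; rewrite /J' /= !ltW.
  by rewrite -[l']subr0; apply: grid_mass_le => //; exact: ltW.
have Jmass i (q : 'cV[R]_s) : (forall j, J' j (q j 0)) ->
    l - m%:R^-1 <= grid_mass c m (J i q) <= l + m%:R^-1.
  move=> /(xB i)[x1 x2]; have lx : l = x i q + l - x i q by rewrite addrC addKr.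
  apply/andP; split.
    rewrite {1}lx; apply: grid_mass_ge => //.
    - by rewrite lerNl -mulrN; apply: le_trans mBc; rewrite ler_pM2l // lerNl.
    - by apply: le_trans mBc; rewrite ler_pM2l.
    - by move=> t /andP[t1 t2]; rewrite /J /= !ltW.
  by rewrite {1}lx; apply: grid_mass_le => //; rewrite lerDl ltW.
have KB w : K w -> forall i, `|w i 0| <= B.
  move=> + i; rewrite -[w]vsubmxK KE => /andP[/forallP hp /forallP hq].
  case: (split_ordP i) => j ->.
    rewrite col_mxEu; have [x1 x2] := xB j _ hq; have /andP[h1 h2] := hp j.
    by rewrite ler_norml; apply/andP; split; lra.
  rewrite col_mxEd; have /andP[h1 h2] := hq j.
  by rewrite ger0_norm // (le_trans h2).
have -> : cube_count (box_mx Theta eps Q) (box_vec s y eps) (d / m%:R) =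
    #|` fset_set [set v : 'cV[int]_(r + s) | K (m%:R^-1 *: real_vec R (1%:M *m v))]|.
  rewrite /cube_count; congr (#|` fset_set _|); apply/seteqP.
  by split=> v /=; rewrite /K mul1mx scalerA.
rewrite (grid_count (mulmx1 1%:M) (mulmx1 1%:M) _ mBc KB) // mulKf; last first.
  by rewrite expf_neq0 ?gt_eqF.
have := @box_mass_fibration_bounds R r s c m K J J' (l - m%:R^-1) (l + m%:R^-1)
  (l' - m%:R^-1) (l' + m%:R^-1) KE.
case/(_ _ _ Jmass J'mass)/andP; [by apply/andP; split; lra|by lra|move=> h1 h2].
have := geta (- m%:R^-1); rewrite normrN gtr0_norm // => /(_ m_eta).
have := geta m%:R^-1; rewrite gtr0_norm // => /(_ m_eta).
rewrite !ler_norml => /andP[g1 g2] /andP[g3 g4].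
by move: h1 h2; rewrite -/(g (- m%:R^-1)) -/(g m%:R^-1) => h1 h2; apply/andP; split; lra.
Qed.

(** * The Moebius sum for a fixed box *)

Lemma coord_gcd_divisor_count (n : nat) (P : pred 'cV[int]_n) (d : nat) : (0 < d)%N ->
  finite_set [set x : 'cV[int]_n | P x] -> finite_set [set x : 'cV[int]_n | P (d%:Z *: x)] ->
  #|` fset_set [set x : 'cV[int]_n | P (d%:Z *: x)]| =
  (\sum_(x <- fset_set [set x : 'cV[int]_n | P x] | coord_gcd x != 0) (d %| coord_gcd x) + P 0%R)%N.
Proof.
move=> d0 fP fdP.
set F := fset_set [set x : 'cV[int]_n | P x].
have FE x : (x \in F) = P x.
  by apply/idP/idP => [|Px]; rewrite in_fset_set ?inE.
have dinj : injective (fun x : 'cV[int]_n => d%:Z *: x).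
  move=> x z /colP xz; apply/colP => i; have := xz i; rewrite !mxE.
  by apply: mulfI; rewrite eqz_nat -lt0n.
have -> : #|` fset_set [set x : 'cV[int]_n | P (d%:Z *: x)]| = (\sum_(x <- F) (d %| coord_gcd x))%N.
  set A := fset_set _.
  have <- : #|` [fset d%:Z *: x | x in A]%fset| = #|` A| by rewrite card_imfset.
  have -> : ([fset d%:Z *: x | x in A] =
             [fset x in F | (d %| coord_gcd x)%N])%fset.
    apply/fsetP => x; rewrite !inE /= FE.
    apply/imfsetP/andP => [[w /=]|[Px /coord_gcd_divide[w xw]]].
      by rewrite in_fset_set // inE => Pw ->; split=> //; exact: coord_gcd_scale.
    by exists w => //=; rewrite in_fset_set // inE /= -xw.
  rewrite card_fset_sum1 big_fset /= big_mkcond /=.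
  by apply: eq_bigr => x _; case: (_ %| _)%N.
rewrite (bigID (fun x => coord_gcd x != 0%N)) /=; congr (_ + _)%N.
have c0 : coord_gcd (0 : 'cV[int]_n) = 0%N by apply/eqP; rewrite coord_gcd_eq0.
under eq_bigl => x do rewrite negbK coord_gcd_eq0.
rewrite -FE; case: (boolP (0 \in F)) => F0.
  rewrite -big_filter (perm_big [:: 0]) ?big_seq1 ?c0 ?dvdn0 //.
  apply: uniq_perm; rewrite ?filter_uniq ?fset_uniq // => x.
  by rewrite mem_filter inE; case: eqP => // ->; rewrite F0.
by rewrite big1_seq // => x /andP[/eqP->]; rewrite (negbTE F0).
Qed.

Lemma fset_set_card_sub (X Y : choiceType) (S : set X) (S' : set Y) (f : X -> Y)
    (P : pred X) : finite_set S -> injective f ->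
  (forall z, S' z <-> exists2 x, S x /\ P x & f x = z) ->
  #|` fset_set S'| = (\sum_(x <- fset_set S) P x)%N.
Proof.
move=> fS finj S'E; rewrite big_seq_fsetE /=.
apply: (@card_fset_set_inj _ _ (fun t : fset_set S => f (val t)) _ (fun t => P (val t))).
- by move=> t t' /finj /val_inj.
- move=> z /S'E[x [Sx Px] <-].
  have xS : x \in fset_set S by rewrite in_fset_set // inE.
  by exists [` xS]%fset.
- move=> t; split=> [Pt|/S'E[x [Sx Px] /finj <-]//].
  apply/S'E; exists (val t) => //; split=> //.
  by have := valP t; rewrite in_fset_set // inE.
Qed.

Lemma absz_shift_lt (k l : int) (w : nat) : `|k - l| <= w%:Z ->
  (absz (k - l + w%:Z)%R < w.*2.+1)%N.
Proof. lia. Qed.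

Lemma absz_shiftK (k l : int) (w : nat) : `|k - l| <= w%:Z ->
  l + (absz (k - l + w%:Z)%R)%:Z - w%:Z = k.
Proof. lia. Qed.

Section FixedBox.
Variables (R : realType) (r s : nat) (Theta : 'M[R]_(r, s)) (y : 'cV[R]_r) (eps Q : R).
Variables (U V : 'M[int]_(r + s)) (M : R).
Hypotheses (eps0 : 0 < eps) (Q0 : 0 < Q).
Hypotheses (UV : U *m V = 1%:M) (VU : V *m U = 1%:M) (M0 : 0 <= M).

Let n := (r + s)%N.
Let A := box_mx Theta eps Q.
Let b := box_vec s y eps.
Let vol := eps ^+ r * Q ^+ s.
Let W d := 2 * (n%:R * M / d) + 1.

Hypothesis VA : forall (x : 'cV[R]_n) i,
  `|(map_mx intr V *m x) i 0| <= M * euclidean_norm (A *m x).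

(** The error of the refinement does not depend on [m], so for every [e] an [m] that brings the
    refined count within [e] of the main term can be inserted. *)
Lemma box_count_approx d : 0 < d ->
  `|(cube_count A b d)%:R - vol / d ^+ n| <= n%:R * (2 * W d ^+ n.-1).
Proof.
move=> d0; apply/ler_addgt0Pr => e e0.
have [m m0 hm] := box_count_volume Theta y eps0 Q0 d0 e0.
have := cube_count_refine b UV VU M0 VA d0 m0; rewrite -/n -/(W d) => h.
set X := (m%:R ^+ n)^-1 * _ in hm h.
rewrite (_ : _ - _ = ((cube_count A b d)%:R - X) + (X - vol / d ^+ n)); last by ring.
by apply: le_trans (ler_normD _ _) _; apply: lerD.
Qed.

(** At [d = u] this bounds [vol] by O(u^n), which is needed where [vol] multiplies the truncation
    error of [1/zeta]. *)
Lemma volume_le d : 0 < d -> vol / d ^+ n <= W d ^+ n + n%:R * (2 * W d ^+ n.-1).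
Proof.
move=> d0; have := box_count_approx d0; have := cube_count_le b UV VU M0 VA d0.
by rewrite ler_norml -/(W d) => h /andP[h1 h2]; lra.
Qed.

Let F := fset_set [set x : 'cV[int]_n | cube_pred A b (real_vec R x)].
Definition div_count (d : nat) :=
  (\sum_(x <- F | coord_gcd x != 0%N) (d %| coord_gcd x))%N.

Let real_vecZ (d : nat) (x : 'cV[int]_n) : real_vec R (d%:Z *: x) = d%:R *: real_vec R x.
Proof. by apply/colP => i; rewrite !mxE intrM. Qed.

Let finF : finite_set [set x : 'cV[int]_n | cube_pred A b (real_vec R x)].
Proof.
have := cube_finite b UV VU M0 VA ltr01; congr finite_set.
by apply/seteqP; split=> x /=; rewrite scale1r.
Qed.

Let FE x : x \in F = cube_pred A b (real_vec R x).
Proof. by apply/idP/idP => [|Px]; rewrite in_fset_set ?inE. Qed.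

(** Multiplication by [d] identifies the points of the shrunk cube with the points of the cube
    divisible by [d]; the last term is the zero vector. *)
Lemma div_countE (d : nat) : (0 < d)%N ->
  cube_count A b d%:R = (div_count d + cube_pred A b 0%R)%N.
Proof.
move=> d0; have r0 : real_vec R 0 = 0 :> 'cV[R]_n by apply/colP => i; rewrite !mxE.
have fd : finite_set [set x : 'cV[int]_n | cube_pred A b (real_vec R (d%:Z *: x))].
  have := @cube_finite _ _ _ _ b _ _ _ UV VU M0 VA d%:R; rewrite ltr0n => /(_ d0).
  by congr finite_set; apply/seteqP; split=> x /=; rewrite real_vecZ.
have := coord_gcd_divisor_count (P := fun x => cube_pred A b (real_vec R x)) d0 finF fd.
rewrite r0 => <-; rewrite /cube_count; congr (#|` fset_set _|).
by apply/seteqP; split=> x /=; rewrite real_vecZ.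
Qed.

Lemma NstarE : Nstar Theta y eps Q = (\sum_(x <- F) (coord_gcd x == 1%N))%N.
Proof.
apply: (@fset_set_card_sub _ _ _ _ (fun x : 'cV[int]_n => (usubmx x, dsubmx x))) => //.
  by move=> x z [xz1 xz2]; rewrite -[x]vsubmxK -[z]vsubmxK xz1 xz2.
have E (x : 'cV[int]_n) : cube_pred A b (real_vec R x) =
  [forall i, 0 <= (real_vec R (usubmx x) + Theta *m real_vec R (dsubmx x) - y) i 0 <= eps]
  && [forall j, 0 <= real_vec R (dsubmx x) j 0 <= Q].
  by rewrite -box_predE // /real_vec -map_col_mx vsubmxK.
move=> [p q]; split=> [[/= pq1 pq2 pq3]|[x [/= Kx /eqP xg] [<- <-]]].
  exists (col_mx p q); rewrite ?col_mxKu ?col_mxKd //=; split; last exact/eqP.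
  by rewrite E col_mxKu col_mxKd; apply/andP; split; apply/forallP.
have := Kx; rewrite E => /andP[/forallP h1 /forallP h2]; split=> //=.
by rewrite vsubmxK.
Qed.

Lemma div_count_le (d : nat) : (0 < d)%N -> (div_count d)%:R <= W d%:R ^+ n.
Proof.
move=> d0; have := @cube_count_le _ _ _ _ b _ _ _ UV VU M0 VA d%:R.
rewrite ltr0n => /(_ d0); apply: le_trans.
by rewrite ler_nat div_countE // leq_addr.
Qed.

Lemma div_count_approx (d : nat) : (0 < d)%N ->
  `|(div_count d)%:R - vol / d%:R ^+ n| <= 1 + n%:R * (2 * W d%:R ^+ n.-1).
Proof.
move=> d0; have := @box_count_approx d%:R; rewrite ltr0n => /(_ d0).
rewrite div_countE // natrD => h.
rewrite (_ : _ - _ = - (cube_pred A b 0)%:R +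
  ((div_count d)%:R + (cube_pred A b 0)%:R - vol / d%:R ^+ n)); last by ring.
apply: le_trans (ler_normD _ _) _; apply: lerD => //.
by rewrite normrN; case: (cube_pred _ _ _); rewrite ?normr1 ?normr0.
Qed.

Let width x x' i : x \in F -> x' \in F ->
  `|((V *m x) i 0)%:~R - ((V *m x') i 0)%:~R| <= n%:R * M :> R.
Proof.
rewrite !FE => /forallP h /forallP h'.
have -> : ((V *m x) i 0)%:~R - ((V *m x') i 0)%:~R =
    (map_mx intr V *m (real_vec R x - real_vec R x')) i 0 :> R.
  by rewrite mulmxBr -!map_mxM !mxE.
apply: le_trans (VA _ i) _; rewrite mulrC ler_wpM2r // -[leRHS]mulr1.
apply: euclidean_norm_le => // j; have := h j; have := h' j; rewrite mulmxBr.
rewrite mxE [(- b) j 0]mxE => /andP[h1 h2].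
rewrite mxE [(- b) j 0]mxE => /andP[h3 h4].
rewrite mxE [(- (A *m _)) j 0]mxE ler_norml; apply/andP; split; lra.
Qed.

(** Unlike the width, the size of a coordinate depends on the position [b] of the cube, which is of
    order [1 / eps]. This is the origin of [delta]. *)
Lemma coord_bound (T : R) x i : (forall j, `|b j 0| + 1 <= T) -> x \in F ->
  `|((V *m x) i 0)%:~R| <= n%:R * M * T :> R.
Proof.
move=> bT; rewrite FE => /forallP h.
have -> : ((V *m x) i 0)%:~R = (map_mx intr V *m (real_vec R x)) i 0 :> R.
  by rewrite -[real_vec R x]/(map_mx intr x) -map_mxM [RHS]mxE.
apply: le_trans (VA _ i) _; rewrite [n%:R * M]mulrC -mulrA ler_wpM2l //.
have T0 : 0 <= T by apply: le_trans (bT i); rewrite addr_ge0.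
apply: euclidean_norm_le => // j; have := h j.
rewrite mxE [(- b) j 0]mxE => /andP[h1 h2]; apply: le_trans (bT j).
rewrite -[X in `|X|](subrK (b j 0)) addrC; apply: le_trans (ler_normD _ _) _.
by rewrite lerD2l ler_norml; apply/andP; split; lra.
Qed.

(** A nonzero [x] has a nonzero coordinate of [V x], and the gcd divides it. This truncates the
    Moebius sum. *)
Lemma coord_gcd_bound (T : R) x : (forall j, `|b j 0| + 1 <= T) -> x \in F ->
  (coord_gcd x <= Num.truncn (n%:R * M * T))%N.
Proof.
move=> bT xF; have [->|g0] := eqVneq (coord_gcd x) 0%N; first by [].
have Vx0 : V *m x != 0.
  apply: contra_neq g0 => Vx; apply/eqP; rewrite coord_gcd_eq0.
  by rewrite -[x]mul1mx -UV -mulmxA Vx mulmx0.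
have [i Vxi] : exists i, (V *m x) i 0 != 0.
  apply/existsP; apply: contraNT Vx0 => /existsPn h; apply/eqP/colP => i.
  by have := h i; rewrite negbK => /eqP ->; rewrite mxE.
rewrite truncn_ge_nat; last by rewrite !mulr_ge0 // (le_trans _ (bT i)) // addr_ge0.
apply: le_trans (coord_bound i bT xF).
rewrite -intr_norm -natr_absz ler_nat dvdn_leq ?absz_gt0 //.
exact: coord_gcd_mulmx.
Qed.

Lemma tail_bound (D D' : nat) (C T G : R) : (forall j, `|b j 0| + 1 <= T) ->
  0 <= C -> 0 <= G ->
  (forall d, (D < d)%N -> (div_count d)%:R <= C) ->
  (forall m : nat, (0 < m)%N -> m%:R <= n%:R * M * T + n%:R * M ->
    (size [seq d <- divisors m | mobius d != 0])%:R <= G) ->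
  \sum_(D.+1 <= d < D'.+1) `|(mobius d)%:~R| * (div_count d)%:R <=
    C * (n%:R * ((2 * (n%:R * M) + 1) * G)).
Proof.
move=> bT C0 G0 hC hG; have nM0 : 0 <= n%:R * M by rewrite mulr_ge0.
have [[x0 x0F]|F0] := pselect (exists x, x \in F); last first.
  rewrite big1 => [|d _]; first by rewrite !mulr_ge0 ?addr_ge0 ?mulr_ge0.
  rewrite /div_count big1_seq ?mulr0 // => x /andP[_ xF].
  by case: F0; exists x.
pose w := Num.truncn (n%:R * M).
have /andP[w1 w2] := truncn_itv nM0; rewrite -/w in w1 w2.
(* All values of the coordinate (V x)_i on the cube are among the z i k. *)
pose z (i : 'I_n) (k : 'I_w.*2.+1) : int := (V *m x0) i 0 + k%:Z - w%:Z.
pose ind d (i : 'I_n) (k : 'I_w.*2.+1) : bool :=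
  [&& z i k != 0, (d %| absz (z i k))%N & mobius d != 0].
(* Every [d] with a nonzero term is charged to a pair [i, k] such that [d] divides the nonzero
   integer [z i k]; exchanging the sums then counts squarefree divisors of each [z i k]. *)
apply: (@le_trans _ _ (\sum_(D.+1 <= d < D'.+1) C * \sum_i \sum_k (ind d i k)%:R)).
  apply: ler_sum_nat => d /andP[Dd _].
  have ind0 : 0 <= C * \sum_i \sum_k (ind d i k)%:R :> R.
    by rewrite mulr_ge0 // sumr_ge0 // => i _; rewrite sumr_ge0.
  have [->|mu0] := eqVneq (mobius d) 0; first by rewrite mulr0z normr0 mul0r.
  have [[x [xF x0' dx]]|nx] := pselect (exists x, [/\ x \in F, coord_gcd x != 0%N & (d %| coord_gcd x)%N]); last first.
    rewrite /div_count big1_seq ?mulr0 // => x /andP[gx xF].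
    by apply/eqP; rewrite eqb0; apply/negP => dx; case: nx; exists x.
  have mu1 : `|(mobius d)%:~R| <= 1 :> R.
    by rewrite -intr_norm -[1]/(1%:~R) ler_int mobius_norm.
  apply: (@le_trans _ _ (1 * C)); first by apply: ler_pM => //; exact: hC.
  rewrite mul1r ler_peMr //.
  have Vx0 : V *m x != 0.
    apply: contra_neq x0' => Vx; apply/eqP; rewrite coord_gcd_eq0.
    by rewrite -[x]mul1mx -UV -mulmxA Vx mulmx0.
  have [i Vxi] : exists i, (V *m x) i 0 != 0.
    apply/existsP; apply: contraNT Vx0 => /existsPn h; apply/eqP/colP => i.
    by have := h i; rewrite negbK => /eqP ->; rewrite mxE.
  have wi : `|(V *m x) i 0 - (V *m x0) i 0| <= w%:Z.
    rewrite -ltzD1 -(ltr_int R) intr_norm intrB intrD.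
    by apply: le_lt_trans (width i xF x0F) _; rewrite natr1.
  have kP := absz_shift_lt wi.
  rewrite (bigD1 i) //= (bigD1 (Ordinal kP)) //=.
  have -> : ind d i (Ordinal kP) = true.
    have zE : z i (Ordinal kP) = (V *m x) i 0 by exact: absz_shiftK.
    by rewrite /ind zE Vxi mu0 andbT coord_gcd_mulmx.
  rewrite -addrA lerDl addr_ge0 ?sumr_ge0 // => j _.
  by rewrite sumr_ge0.
rewrite -mulr_sumr ler_wpM2l // exchange_big /=.
apply: (@le_trans _ _ (\sum_(i < n) (2 * (n%:R * M) + 1) * G)); last first.
  by rewrite sumr_const card_ord -[leLHS]mulr_natl.
apply: ler_sum => i _; rewrite exchange_big /=.
apply: (@le_trans _ _ (\sum_(k < w.*2.+1) G)); last first.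
  rewrite sumr_const card_ord -[leLHS]mulr_natl ler_wpM2r //.
  by rewrite -natr1 -muln2 natrM lerD2r mulrC ler_wpM2l.
apply: ler_sum => k _.
have [z0|z0] := eqVneq (z i k) 0.
  by rewrite big1 // => d _; rewrite /ind z0 eqxx.
(* The value [z i k] need not be attained on the cube, so it is bounded through [x0] and the offset,
   which is at most [w]. *)
apply: le_trans (hG (absz (z i k)) _ _); last 2 first.
- by rewrite absz_gt0.
- rewrite natr_absz intr_norm /z intrB intrD -addrA.
  apply: le_trans (ler_normD _ _) _; apply: lerD; first exact: coord_bound.
  have kw := ltn_ord k; rewrite ler_norml; apply/andP; split.
    by rewrite lerNl opprB lerBlDr (le_trans w1) // lerDl.
  apply: le_trans w1; rewrite lerBlDr -[w%:~R]/(w%:R) -[k%:Z%:~R]/(k%:R).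
  by rewrite -natrD ler_nat addnn -ltnS.
rewrite -natr_sum ler_nat.
have -> : (\sum_(D.+1 <= d < D'.+1) ind d i k)%N =
    size [seq d <- index_iota D.+1 D'.+1 | ind d i k].
  rewrite size_filter -sum1_count [RHS]big_mkcond /=; apply: eq_bigr => d _.
  by case: (ind d i k).
apply: uniq_leq_size; first by rewrite filter_uniq // iota_uniq.
move=> d; rewrite !mem_filter => /andP[/and3P[_ dz ->] _] /=.
by rewrite -dvdn_divisors // absz_gt0.
Qed.

(** For [d <= u] one has [W d <= W0 * u / d], so the error is [O((u/d)^(n-1))]. The sum of
    [d^-(n-1)] is at most 2 for [n >= 3] and harmonic for [n = 2]; the right side adds both
    cases. *)
Lemma head_bound (D : nat) (u W0 : R) : (1 < n)%N -> 1 <= u -> D%:R <= u -> (0 < D)%N ->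
  0 <= W0 -> 2 * (n%:R * M) + u <= W0 * u ->
  \sum_(1 <= d < D.+1) `|(mobius d)%:~R * ((div_count d)%:R - vol / d%:R ^+ n)| <=
    (1 + n%:R * (2 * W0 ^+ n.-1)) * (2 * u ^+ n.-1 + u * (1 + ln u)).
Proof.
move=> n1 u1 Du D0 W00 hW; have u0 : 0 < u by apply: lt_le_trans u1.
apply: (@le_trans _ _ (\sum_(1 <= d < D.+1)
    (1 + n%:R * (2 * W0 ^+ n.-1)) * (u ^+ n.-1 * (d%:R ^+ n.-1)^-1))).
  apply: ler_sum_nat => d /andP[d0 dD].
  have dR : 0 < d%:R :> R by rewrite ltr0n.
  have du : d%:R <= u by apply: le_trans Du; rewrite ler_nat.
  have mu1 : `|(mobius d)%:~R| <= 1 :> R.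
    by rewrite -intr_norm -[1]/(1%:~R) ler_int mobius_norm.
  rewrite normrM -[leRHS]mul1r; apply: ler_pM => //.
  apply: le_trans (div_count_approx d0) _.
  have ud : 1 <= u / d%:R by rewrite ler_pdivlMr // mul1r.
  rewrite -exprVn -exprMn [leRHS]mulrDl mul1r; apply: lerD; first exact: exprn_ege1.
  rewrite -!mulrA ler_wpM2l // ler_wpM2l // -exprMn lerXn2r ?nnegrE //.
  - by rewrite /W addr_ge0 // !mulr_ge0 ?invr_ge0.
  - by rewrite mulr_ge0 // (le_trans _ ud).
  rewrite /W mulrA [leRHS]mulrA -ler_pdivrMr ?invr_gt0 // invrK mulrDl mul1r.
  rewrite !mulrA divfK ?gt_eqF // -mulrA; apply: le_trans hW.
  by rewrite lerD2l.
rewrite -mulr_sumr ler_wpM2l ?addr_ge0 ?mulr_ge0 ?exprn_ge0 // -mulr_sumr.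
have lnu : 0 <= ln u by exact: ln_ge0.
case: n n1 => [|[|[|n']]] //= _.
  rewrite expr1; apply: (@le_trans _ _ (u * (1 + ln u))); last first.
    by rewrite lerDr mulr_ge0 // ltW.
  rewrite ler_pM2l //; case: D Du D0 => // D Du _.
  apply: le_trans (harmonic_le_ln R D) _; rewrite lerD2l ler_ln ?posrE //.
apply: (@le_trans _ _ (u ^+ n'.+2 * 2)); last first.
  by rewrite [leLHS]mulrC lerDl mulr_ge0 ?addr_ge0 // ltW.
rewrite ler_pM2l ?exprn_gt0 //.
have := @zeta_sum_le R n' 1 D isT; rewrite expr1n invr1.
rewrite {2}/zeta_sum big_nat1 expr1n invr1; exact: le_trans.
Qed.

(** The three summands are the errors of the counts with [d <= u], the total of the counts with
    [d > u], and [vol] times the truncation error of [1/zeta]. The condition on [W0] also gives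
    [W d <= W0] for [d >= u]. *)
Lemma Nstar_bound (u W0 T G : R) : (1 < n)%N -> 1 <= u -> 0 <= W0 -> 0 <= G ->
  2 * (n%:R * M) + u <= W0 * u -> (forall j, `|b j 0| + 1 <= T) ->
  (forall m : nat, (0 < m)%N -> m%:R <= n%:R * M * T + n%:R * M ->
    (size [seq d <- divisors m | mobius d != 0])%:R <= G) ->
  `|(Nstar Theta y eps Q)%:R - vol / zeta (n%:R : R)| <=
    (1 + n%:R * (2 * W0 ^+ n.-1)) * (2 * u ^+ n.-1 + u * (1 + ln u)) +
    W0 ^+ n * (n%:R * (W0 * u * G)) +
    (W0 ^+ n + n%:R * (2 * W0 ^+ n.-1)) * 4 ^+ n.-1 * (u * (1 + ln u)).
Proof.
move=> n1 u1 W00 G0 hW bT hG; have u0 : 0 < u by apply: lt_le_trans u1.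
pose D := Num.truncn u.
have /andP[Du uD] := truncn_itv (ltW u0); rewrite -/D in Du uD.
have D0 : (0 < D)%N by rewrite truncn_gt0.
have DR : 0 < D%:R :> R by rewrite ltr0n.
pose D' := maxn D (Num.truncn (n%:R * M * T)).
have WW d : u <= d -> W d <= W0.
  move=> ud; have d0 : 0 < d by apply: lt_le_trans ud.
  rewrite /W mulrA; apply: (@le_trans _ _ (2 * (n%:R * M) / u + 1)).
    rewrite lerD2r ler_wpM2l ?mulr_ge0 // lef_pV2 ?posrE //.
  by rewrite -(ler_pM2r u0) mulrDl divfK ?gt_eqF // mul1r.
have W_ge0 d : 0 < d -> 0 <= W d.
  by move=> d0; rewrite /W addr_ge0 // !mulr_ge0 ?invr_ge0 // ltW.
have WX d k : u <= d -> W d ^+ k <= W0 ^+ k.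
  by move=> ud; rewrite lerXn2r ?nnegrE ?WW ?W_ge0 // (lt_le_trans u0).
have NE : (Nstar Theta y eps Q)%:R =
    \sum_(1 <= d < D'.+1) (mobius d)%:~R * (div_count d)%:R :> R.
  have := @primitive_count _ F (@coord_gcd n) D' _; rewrite -NstarE => h.
  rewrite -[LHS]/((Nstar Theta y eps Q)%:Z%:~R) -natz h.
    by rewrite rmorph_sum /=; apply: eq_bigr => d _; rewrite intrM natz.
  by move=> x xF; rewrite leq_max (coord_gcd_bound bT xF) orbT.
rewrite NE (@big_cat_nat _ _ _ D.+1) //=; last by rewrite ltnS leq_maxl.
set S2 := \sum_(D.+1 <= d < D'.+1) _.
have S2le : `|S2| <= W0 ^+ n * (n%:R * (W0 * u * G)).
  apply: (@le_trans _ _ (\sum_(D.+1 <= d < D'.+1) `|(mobius d)%:~R| * (div_count d)%:R)).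
    apply: le_trans (ler_norm_sum _ _ _) _; apply: ler_sum => d _.
    by rewrite normrM [X in _ * X]ger0_norm.
  apply: (@le_trans _ _ (W0 ^+ n * (n%:R * ((2 * (n%:R * M) + 1) * G)))).
    apply: tail_bound bT _ G0 _ hG; first by rewrite exprn_ge0.
    move=> d Dd; have d0 : (0 < d)%N by apply: leq_ltn_trans Dd.
    apply: le_trans (div_count_le d0) _; apply: WX.
    by apply: le_trans (ltW uD) _; rewrite ler_nat.
  rewrite ler_wpM2l ?exprn_ge0 // ler_wpM2l // ler_wpM2r //.
  by apply: le_trans hW; rewrite lerD2l.
have vol0 : 0 <= vol by rewrite mulr_ge0 ?exprn_ge0 ?ltW.
have lnu : 0 <= ln u by exact: ln_ge0.
pose CV := W0 ^+ n + n%:R * (2 * W0 ^+ n.-1).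
have CV0 : 0 <= CV by rewrite addr_ge0 ?mulr_ge0 ?exprn_ge0.
have volle : vol <= CV * u ^+ n.
  rewrite -ler_pdivrMr ?exprn_gt0 //; apply: le_trans (volume_le u0) _.
  by rewrite lerD ?ler_wpM2l ?WX.
set S1 := \sum_(1 <= d < D.+1) _.
pose S3 : R := \sum_(1 <= d < D.+1) (mobius d)%:~R * (d%:R ^+ n)^-1.
have S3le : `|vol * (S3 - (zeta (n%:R : R))^-1)| <= CV * 4 ^+ n.-1 * (u * (1 + ln u)).
  rewrite normrM (ger0_norm vol0).
  (* One factor [2 ^+ n.-1] comes from [sum_mobius_approx], the other from [u <= 2 * D]. What
     remains of the powers of [u] is [u] itself. *)
  apply: (@le_trans _ _ (CV * u ^+ n * (2 ^+ n.-1 * (1 + ln u) * (2 ^+ n.-1 / u ^+ n.-1)))).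
    apply: ler_pM => //; rewrite /S3; case: n n1 => [|[|n']] //= _.
    apply: le_trans (sum_mobius_approx R n' D0) _.
    apply: ler_pM; rewrite ?mulr_ge0 ?exprn_ge0 ?addr_ge0 ?invr_ge0 ?exprn_ge0 //.
    - by apply: ln_ge0; rewrite ler1n.
    - by rewrite ler_wpM2l ?exprn_ge0 // lerD2l ler_ln ?posrE.
    - rewrite -exprVn -expr_div_n lerXn2r ?nnegrE ?divr_ge0 ?invr_ge0 ?(ltW u0) //.
      rewrite -[2 / u]invf_div lef_pV2 ?posrE ?divr_gt0 // ler_pdivrMr //.
      apply: le_trans (ltW uD) _; rewrite -natr1 mulrC mulr2n mulrDl mul1r lerD2l.
      by rewrite ler1n.
  rewrite le_eqVlt; apply/orP; left; apply/eqP.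
  rewrite (_ : 4 = 2 * 2 :> R); last by rewrite -natrM.
  rewrite exprMn; case: n n1 => // n' _; rewrite [n'.+1.-1]/= exprS.
  by field; rewrite expf_neq0 // gt_eqF.
have -> : S1 + S2 - vol / zeta (n%:R : R) =
    (S1 - vol * S3) + S2 + vol * (S3 - (zeta (n%:R : R))^-1) by ring.
apply: le_trans (ler_normD _ _) _; apply: lerD S3le.
apply: le_trans (ler_normD _ _) _; apply: lerD S2le.
rewrite /S1 /S3 mulr_sumr -sumrB; apply: le_trans (ler_norm_sum _ _ _) _.
apply: le_trans (head_bound n1 u1 Du D0 W00 hW).
rewrite le_eqVlt; apply/orP; left; apply/eqP; apply: eq_bigr => d _.
by rewrite mulrBr mulrCA.
Qed.

End FixedBox.

(** * The first minimum of the lattice and the choice of parameters *)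

Lemma euclidean_normZ (R : realType) (n : nat) (a : R) (v : 'cV[R]_n) : 0 <= a ->
  euclidean_norm (a *: v) = a * euclidean_norm v.
Proof.
move=> a0; rewrite /euclidean_norm -[a in RHS]ger0_norm // -sqrtr_sqr -sqrtrM ?sqr_ge0 //.
by congr (Num.sqrt _); rewrite mulr_sumr; apply: eq_bigr => i _; rewrite mxE exprMn.
Qed.

Lemma euclidean_norm_col_mx (R : realType) (r s : nat) (v : 'cV[R]_r) (w : 'cV[R]_s) :
  euclidean_norm v <= euclidean_norm (col_mx v w) /\
  euclidean_norm w <= euclidean_norm (col_mx v w).
Proof.
have E : \sum_i (col_mx v w) i 0 ^+ 2 = \sum_i v i 0 ^+ 2 + \sum_i w i 0 ^+ 2.
  rewrite big_split_ord /=; congr (_ + _); apply: eq_bigr => i _.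
    by rewrite col_mxEu.
  by rewrite col_mxEd.
have ge0 k (z : 'cV[R]_k) : 0 <= \sum_i z i 0 ^+ 2.
  by apply: sumr_ge0 => i _; rewrite sqr_ge0.
by rewrite /euclidean_norm E !ler_sqrt ?addr_ge0 // lerDl lerDr.
Qed.

Lemma euclidean_norm_int_ge1 (R : realType) (n : nat) (x : 'cV[int]_n) : x != 0 ->
  1 <= euclidean_norm (real_vec R x).
Proof.
move=> x0; have [i xi] : exists i, x i 0 != 0.
  apply/existsP; apply: contraNT x0 => /existsPn h; apply/eqP/colP => i.
  by have := h i; rewrite negbK => /eqP ->; rewrite mxE.
rewrite /euclidean_norm -[leLHS]sqrtr1 ler_sqrt; last first.
  by apply: sumr_ge0 => j _; rewrite sqr_ge0.
rewrite (bigD1 i) //= -[leLHS]addr0; apply: lerD; last first.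
  by apply: sumr_ge0 => j _; rewrite sqr_ge0.
rewrite mxE -rmorphXn /= -[1]/(1%:~R) ler_int -gtz0_ge1 lt0r sqr_ge0 andbT.
by rewrite expf_neq0.
Qed.

(** If [q = 0], then [|p| / eps >= 1]. If [|q| >= Q / u], the second block is long enough. Otherwise
    [|q| <= Q], so [phi |q| >= phi Q], and the first block is at least [phi Q / (eps |q|^beta) >=
    phi Q u^beta / (eps Q^beta)], which equals [1/u] by the choice of [u]. *)
Lemma box_lattice_min (R : realType) (r s : nat) (beta : R) (Theta : 'M[R]_(r, s))
    (phi : R -> R) (eps Q u : R) : 0 < beta ->
  (forall x, 1 <= x -> 0 < phi x <= 1) ->
  (forall x x', 1 <= x -> x <= x' -> phi x' <= phi x) ->
  (forall (p : 'cV[int]_r) (q : 'cV[int]_s), q != 0 ->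
      phi (euclidean_norm (real_vec R q)) <=
      euclidean_norm (real_vec R p + Theta *m real_vec R q) *
        euclidean_norm (real_vec R q) `^ beta) ->
  0 < eps <= 1 -> 1 <= Q -> 1 <= u -> u `^ (1 + beta) = eps * Q `^ beta / phi Q ->
  forall x : 'cV[int]_(r + s), x != 0 ->
    u^-1 <= euclidean_norm (box_mx Theta eps Q *m real_vec R x).
Proof.
move=> b0 phi_r phi_n Th /andP[e0 e1] Q1 u1 uE x x0.
have Q0 : 0 < Q by apply: lt_le_trans Q1.
have u0 : 0 < u by apply: lt_le_trans u1.
have ui : u^-1 <= 1 by rewrite invf_le1.
pose p := usubmx x; pose q := dsubmx x.
have -> : real_vec R x = col_mx (real_vec R p) (real_vec R q).
  by rewrite /real_vec -map_col_mx vsubmxK.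
rewrite box_mxE.
have [h1 h2] := euclidean_norm_col_mx (eps^-1 *: (real_vec R p + Theta *m real_vec R q))
  (Q^-1 *: real_vec R q).
rewrite euclidean_normZ ?invr_ge0 ?(ltW e0) // in h1.
rewrite euclidean_normZ ?invr_ge0 ?(ltW Q0) // in h2.
have [q0|q0] := eqVneq q 0.
  apply: le_trans h1; apply: le_trans ui _.
  have r0 : real_vec R q = 0 by rewrite q0; apply/colP => i; rewrite !mxE.
  rewrite r0 mulmx0 addr0; apply: mulr_ege1; first by rewrite invf_ge1.
  apply: euclidean_norm_int_ge1; apply: contraNneq x0 => p0.
  by rewrite -[x]vsubmxK -/p -/q p0 q0 col_mx0.
have N1 := euclidean_norm_int_ge1 R q0.
set N := euclidean_norm (real_vec R q) in N1 h2.
have [NQ|NQ] := leP (Q / u) N.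
  by apply: le_trans h2; rewrite mulrC ler_pdivlMr // mulrC.
apply: le_trans h1; have N0 : 0 < N by apply: lt_le_trans N1.
have NQ' : N <= Q by apply: le_trans (ltW NQ) _; rewrite ler_pdivrMr // ler_peMr // ltW.
have /andP[ph0 _] := phi_r _ Q1.
have h3 := le_trans (phi_n _ _ N1 NQ') (Th p q q0).
have Nb0 : 0 < N `^ beta by exact: powR_gt0.
rewrite -ler_pdivrMr // in h3.
apply: (@le_trans _ _ (eps^-1 * (phi Q / N `^ beta))); last first.
  by rewrite ler_wpM2l // invr_ge0 ltW.
have Nu : N `^ beta <= Q `^ beta / u `^ beta.
  rewrite ler_pdivlMr ?powR_gt0 // -powRM ?(ltW N0) ?(ltW u0) //.
  apply: (ge0_ler_powR (ltW b0)); rewrite ?nnegrE ?mulr_ge0 ?(ltW N0) ?(ltW u0) ?(ltW Q0) //.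
  by rewrite -ler_pdivlMr // ltW.
apply: (@le_trans _ _ (eps^-1 * (phi Q / (Q `^ beta / u `^ beta)))); last first.
  rewrite ler_wpM2l ?invr_ge0 ?(ltW e0) // ler_wpM2l ?(ltW ph0) //.
  by rewrite lef_pV2 ?posrE // divr_gt0 ?powR_gt0.
have uu : u `^ (1 + beta) = u * u `^ beta.
  by rewrite powRD ?powRr1 ?(ltW u0) ?(gt_eqF u0) ?implybT.
have Qb0 : 0 < Q `^ beta by exact: powR_gt0.
have ub0 : 0 < u `^ beta by exact: powR_gt0.
have phE : phi Q = eps * Q `^ beta / (u * u `^ beta).
  by rewrite -uu uE; field; rewrite !gt_eqF.
rewrite phE le_eqVlt; apply/orP; left; apply/eqP.
by field; rewrite !gt_eqF.
Qed.

Theorem corollary2p2 (R : realType) (r s : nat) (hr : (1 <= r)%N)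
    (hs : (1 <= s)%N) (beta : R) (hbeta : 0 < beta) (Theta : 'M[R]_(r, s))
    (phi : R -> R)
    (phi_range : forall x, 1 <= x -> 0 < phi x <= 1)
    (phi_noninc : forall x x', 1 <= x -> x <= x' -> phi x' <= phi x)
    (Theta_phi : forall (p : 'cV[int]_r) (q : 'cV[int]_s), q != 0 ->
      phi (euclidean_norm (real_vec R q)) <=
      euclidean_norm (real_vec R p + Theta *m real_vec R q) *
        euclidean_norm (real_vec R q) `^ beta)
    (y : 'cV[R]_r) (eps : R -> R)
    (eps_range : forall Q, 1 <= Q -> 0 < eps Q <= 1)
    (eps_infty : eps Q * Q `^ beta @[Q --> +oo] --> +oo)
    (a : R) (ha : 2 < a) :
  let u Q := (eps Q * Q `^ beta / phi Q) `^ (1 / (1 + beta)) in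
  let delta Q := (1 / phi Q * (Q / eps Q) `^ beta) `^ (1 / (1 + beta)) in
  exists2 C : R, 0 < C & \forall Q \near +oo,
    `|(Nstar Theta y (eps Q) Q)%:R - eps Q ^+ r * Q ^+ s / zeta ((r + s)%:R : R)|
    <= C * (u Q ^+ (r + s - 1)
            + u Q * a `^ (ln (delta Q) / ln (ln (delta Q)))).
Proof.
move=> u delta; pose n := (r + s)%N; have n1 : (1 < n)%N by rewrite (leq_add hr hs).
have [Cn Cn0 HC] := dual_reduced_basis R n.
pose Y := \sum_i `|y i 0|; have Y0 : 0 <= Y by exact: sumr_ge0.
(* The integers to be factored are at most [n Cn u ((Y + 1) / eps + 1)]. As [eps <= 1] and
   [delta = u / eps], this is at most [K * delta]. *)
pose K := n%:R * Cn * (Y + 2).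
have [T1 HT1] := sqfree_divisors_bound K ha.
have a1 : 1 < a by lra.
have [T2 T21 HT2] := log_le_powR_log a1.
(* Both thresholds concern [log delta]; since [u <= delta], it suffices that [u >= B0]. *)
pose T := Num.max T1 T2; pose B0 := expR T.
have T1T : T1 <= T by rewrite /T le_max lexx.
have T2T : T2 <= T by rewrite /T le_max lexx orbT.
have B01 : 1 <= B0 by rewrite -expR0 ler_expR; lra.
pose W0 := 2 * (n%:R * Cn) + 1.
have nC0 : 0 <= n%:R * Cn by rewrite mulr_ge0 // ltW.
have W00 : 0 <= W0 by rewrite /W0; lra.
pose H := 1 + n%:R * (2 * W0 ^+ n.-1).
pose CV := (W0 ^+ n + n%:R * (2 * W0 ^+ n.-1)) * 4 ^+ n.-1.
have H0 : 0 < H.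
  by rewrite /H ltr_pwDl // !mulr_ge0 ?exprn_ge0.
have CV0 : 0 <= CV by rewrite !(mulr_ge0, addr_ge0) ?exprn_ge0.
have T0 : 0 <= W0 ^+ n * (n%:R * W0) by rewrite !mulr_ge0 ?exprn_ge0.
exists (2 * H + W0 ^+ n * (n%:R * W0) + CV); first lra.
have p0 : 0 < 1 / (1 + beta) by rewrite divr_gt0 //; lra.
near=> Q.
have Q1 : 1 <= Q by near: Q; exact: nbhs_pinfty_ge.
(* Since [phi Q <= 1], this lower bound for [eps Q * Q^beta] yields [u Q >= B0]. *)
have big : B0 `^ (1 + beta) <= eps Q * Q `^ beta.
  near: Q; have /cvgryPge := eps_infty; exact.
have Q0 : 0 < Q by apply: lt_le_trans Q1.
have /andP[e0 e1] := eps_range _ Q1.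
have /andP[ph0 ph1] := phi_range _ Q1.
have B00 : 0 < B0 by exact: expR_gt0.
have Qb0 : 0 < Q `^ beta by exact: powR_gt0.
have X0 : 0 < eps Q * Q `^ beta / phi Q by rewrite divr_gt0 // mulr_gt0.
have uB : B0 <= u Q.
  have -> : B0 = (B0 `^ (1 + beta)) `^ (1 / (1 + beta)).
    by rewrite -powRrM mul1r mulfV ?powRr1 ?(ltW B00) // gt_eqF //; lra.
  apply: (ge0_ler_powR (ltW p0)); rewrite ?nnegrE ?powR_ge0 ?(ltW X0) //.
  by apply: le_trans big _; rewrite ler_pdivlMr // ler_piMr // mulr_ge0 // ltW.
have u1 : 1 <= u Q by apply: le_trans uB.
have u0 : 0 < u Q by apply: lt_le_trans u1.
have uE : u Q `^ (1 + beta) = eps Q * Q `^ beta / phi Q.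
  by rewrite /u -powRrM mul1r mulVf ?powRr1 ?(ltW X0) // gt_eqF //; lra.
(* The two sides differ in the power of [eps Q] only, where
   [- beta / (1 + beta) = 1 / (1 + beta) - 1]; taking logarithms makes the identity linear. *)
have dE : delta Q = u Q / eps Q.
  have Qe0 : 0 < (Q / eps Q) `^ beta by rewrite powR_gt0 // divr_gt0.
  have d0 : 0 < delta Q by rewrite powR_gt0 // mulr_gt0 // divr_gt0.
  rewrite -[LHS]lnK ?posrE // -[RHS]lnK ?posrE ?divr_gt0 //; congr expR.
  have l1 : ln (1 / phi Q) = - ln (phi Q) by rewrite div1r lnV ?posrE.
  have l2 : ln ((Q / eps Q) `^ beta) = beta * (ln Q - ln (eps Q)).
    by rewrite ln_powR ln_div ?posrE.
  have l3 : ln (eps Q * Q `^ beta / phi Q) = ln (eps Q) + beta * ln Q - ln (phi Q).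
    by rewrite ln_div ?posrE ?mulr_gt0 // lnM ?posrE // ln_powR.
  rewrite [RHS]ln_div ?posrE // /u /delta !ln_powR l3 lnM ?posrE ?divr_gt0 // l1 l2.
  by field; rewrite gt_eqF //; lra.
have ud : u Q <= delta Q by rewrite dE ler_pdivlMr // ler_piMr // ltW.
have d0 : 0 < delta Q by apply: lt_le_trans ud.
have lud : ln (u Q) <= ln (delta Q) by rewrite ler_ln ?posrE.
have lT : T <= ln (u Q) by rewrite -[T]expRK ler_ln ?posrE.
set G := a `^ _.
have G0 : 0 <= G by exact: powR_ge0.
have lG : 1 + ln (u Q) <= G.
  apply: (@le_trans _ _ (1 + ln (delta Q))); first by rewrite lerD2l.
  by apply: HT2; lra.
have Amin := box_lattice_min hbeta phi_range phi_noninc Theta_phi (eps_range _ Q1) Q1 u1 uE.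
have ui0 : 0 < (u Q)^-1 by rewrite invr_gt0.
have [U [V [UV VU VA]]] := HC _ _ _ ui0 Amin.
pose M := Cn * u Q; have M0 : 0 <= M by rewrite mulr_ge0 // ltW.
have VA' (x : 'cV[R]_n) i : `|(map_mx intr V *m x) i 0| <=
    M * euclidean_norm (box_mx Theta (eps Q) Q *m x).
  by apply: le_trans (VA x i) _; rewrite invrK /M mulrA mulrAC.
have bT j : `|box_vec s y (eps Q) j 0| + 1 <= (Y + 1) / eps Q.
  have ei : 1 <= (eps Q)^-1 by rewrite invf_ge1.
  rewrite mulrDl mul1r; apply: lerD => //.
  rewrite /box_vec; case: (split_ordP j) => i ->.
    rewrite col_mxEu mxE normrM gtr0_norm ?invr_gt0 // mulrC ler_pM2r ?invr_gt0 //.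
    by rewrite /Y (bigD1 i) //= lerDl sumr_ge0.
  by rewrite col_mxEd mxE normr0 divr_ge0 // ltW.
have hW : 2 * (n%:R * M) + u Q <= W0 * u Q by rewrite /W0 /M; lra.
have hG (m : nat) : (0 < m)%N -> m%:R <= n%:R * M * ((Y + 1) / eps Q) + n%:R * M ->
    (size [seq d <- divisors m | mobius d != 0])%:R <= G.
  move=> m0 hm; apply: HT1 => //; first lra.
  rewrite lnK ?posrE //; apply: le_trans hm _; rewrite /K /M dE.
  apply: (@le_trans _ _ (n%:R * Cn * u Q * ((Y + 1) / eps Q) + n%:R * Cn * (u Q / eps Q))).
    by rewrite [n%:R * (Cn * u Q)]mulrA lerD2l ler_wpM2l // ler_pdivlMr // ler_piMr // ltW.
  by rewrite le_eqVlt; apply/orP; left; apply/eqP; field; rewrite gt_eqF.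
have := Nstar_bound e0 Q0 UV VU M0 VA' n1 u1 W00 G0 hW bT hG.
move=> h; apply: le_trans h _; rewrite subn1 -/n -/H -/CV.
have P0 : 0 <= u Q ^+ n.-1 by rewrite exprn_ge0 // ltW.
have uG : u Q * (1 + ln (u Q)) <= u Q * G by rewrite ler_pM2l.
have uG0 : 0 <= u Q * G by rewrite mulr_ge0 // ltW.
have g1 := ler_wpM2l (ltW H0) uG; have g2 := ler_wpM2l CV0 uG.
have g3 := mulr_ge0 (ltW H0) uG0; have g4 := mulr_ge0 T0 P0.
have g5 := mulr_ge0 CV0 P0.
rewrite mulrDr; lra.
Unshelve. all: by end_near. Qed.
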